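(* Let $0<\gamma\le 1$, let $P_0$ be a probability measure on $\mathbb{R}^k$ such that $P_0(H)<\gamma$ for every hyperplane $H\subset\mathbb{R}^k$, and let $(P_t)_{t\ge 1}$ be a sequence of probability measures on $\mathbb{R}^k$ with $P_t\to P_0$ weakly as $t\to\infty$. Then there exist $R>0$ and $t_0\ge 1$ such that for $t=0$ and for all $t\ge t_0$ there exists $\phi_t\in K_t^R(\gamma)$ which minimizes $\det(C_t(\phi))$ over $\phi\in K_t(\gamma)$.
   Context: For a probability measure $P$ on $\mathbb{R}^k$ let $K_P(\gamma)$ be the set of measurable functions $\phi:\mathbb{R}^k\to[0,1]$ with $\int\phi\,dP\ge\gamma$ and $\int\|x\|^2\phi(x)\,P(dx)<\infty$. For $\phi\in K_P(\gamma)$ define the trimmed mean and trimmed covariance $$T_P(\phi)=\frac{1}{\int\phi\,dP}\int x\,\phi(x)\,P(dx),\qquad C_P(\phi)=\frac{1}{\int\phi\,dP}\int (x-T_P(\phi))(x-T_P(\phi))'\phi(x)\,P(dx).$$ For $t\ge 0$ write $K_t(\gamma)=K_{P_t}(\gamma)$, $T_t=T_{P_t}$, $C_t=C_{P_t}$. For $R>0$ let $B_R=\{x\in\mathbb{R}^k:\|x\|\le R\}$ and $K_t^R(\gamma)=\{\phi\in K_t(\gamma):\{\phi\ne 0\}\subset B_R\}$. Hyperplanes are affine hyperplanes.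
   Formalization: The formal theorem assumes 0<γ<1 instead of 0<γ≤1: at γ=1 the claim fails (e.g. all P_t = P_0 = N(0,1) on R, where no φ supported in a ball B_R has ∫φ dP_0 ≥ 1). *)

(* Defs.v *)
From HB Require Import structures.
From mathcomp Require Import all_boot all_order all_algebra.
From mathcomp Require Import all_classical all_reals all_analysis.

Set Implicit Arguments.
Unset Strict Implicit.
Unset Printing Implicit Defensive.

Import Order.TTheory GRing.Theory Num.Theory.
Import numFieldNormedType.Exports.

Local Open Scope classical_set_scope.
Local Open Scope ring_scope.

(* Points of R^k are row vectors.  MathComp-Analysis gives 'rV[R]_k a topology
   but no sigma-algebra; borelRV is convertible to 'rV[R]_k. *)
Definition borelRV (R : realType) (k : nat) :=
  g_sigma_algebraType [set A : set 'rV[R]_k | open A].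

Section trimming.
Context {R : realType} {k : nat}.
Implicit Types (P : probability (borelRV R k) R) (phi psi : borelRV R k -> R).

(* The norm `|x| that the library puts on 'rV[R]_k is the sup norm. *)
Definition enorm (x : 'rV[R]_k) : R := Num.sqrt (\sum_(i < k) x 0 i ^+ 2).

Definition enorm_ball (r : R) : set 'rV[R]_k := [set x | enorm x <= r].

Definition hyperplane (H : set 'rV[R]_k) : Prop :=
  exists (a : 'rV[R]_k) (b : R),
    a != 0 /\ H = [set x | \sum_(i < k) a 0 i * x 0 i = b].

Definition weak_cvg (P_ : nat -> probability (borelRV R k) R) P : Prop :=
  forall f : 'rV[R]_k -> R, continuous f ->
    (exists M : R, forall x, `|f x| <= M) ->
    (fun t => \int[P_ t]_x f x) @ \oo --> (\int[P]_x f x).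

Definition trim_class P (gamma : R) phi : Prop :=
  [/\ measurable_fun [set: borelRV R k] phi,
    forall x, 0 <= phi x <= 1,
    (gamma%:E <= \int[P]_x (phi x)%:E)%E &
    (\int[P]_x (enorm x ^+ 2 * phi x)%:E < +oo)%E].

Definition trim_class_ball P (gamma r : R) phi : Prop :=
  trim_class P gamma phi /\ [set x | phi x != 0] `<=` enorm_ball r.

Definition trim_mass P phi : R := \int[P]_x phi x.

(* \int here is Rintegral, which is 0 on divergent integrals; every integrand
   below is integrable when phi is in trim_class P gamma. *)
Definition trim_mean P phi : 'rV[R]_k :=
  (trim_mass P phi)^-1 *: \row_i \int[P]_x ((x : 'rV[R]_k) 0 i * phi x).

(* With row vectors, the outer product (x - T)(x - T)' reads
   (x - T)^T *m (x - T). *)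
Definition trim_cov P phi : 'M[R]_k :=
  let T := trim_mean P phi in
  (trim_mass P phi)^-1 *:
    \matrix_(i, j) \int[P]_x ((((x : 'rV[R]_k) - T)^T *m (x - T)) i j * phi x).

Definition minimizes_det_cov P (gamma : R) phi : Prop :=
  trim_class P gamma phi /\
  forall psi, trim_class P gamma psi ->
    \det (trim_cov P phi) <= \det (trim_cov P psi).

End trimming.

(* Main.v *)
(* For det A = 1 and any b, the average over phi of |A x + b|^2 equals
   tr (A C A^T) + |A T + b|^2 with T, C the trimmed mean and covariance, so by
   Hadamard's inequality and AM-GM it is at least k (det C)^(1/k), with equality
   for a suitable (A, b).  Minimizing det C over phi is therefore the same as
   minimizing this average jointly over phi and (A, b).  For fixed (A, b) an
   optimal phi is explicit: the indicator of an ellipsoid, plus a fraction of its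
   boundary, of total mass gamma.  Coercivity in (A, b) follows from the
   hyperplane condition, uniformly in t: by Lagrangian duality it reduces to
   integrals of bounded continuous functions, equicontinuous in the direction,
   so that weak convergence and compactness of the sphere apply.  Hence only a
   compact set of (A, b) matters, the corresponding ellipsoids lie in a common
   ball, and the extreme value theorem in (A, b) gives the minimizer. *)

Require Import Defs.
From HB Require Import structures.
From mathcomp Require Import all_boot all_order all_algebra.
From mathcomp Require Import all_classical all_reals all_analysis.
From mathcomp Require Import perm measurable_realfun.
From mathcomp Require Import ring lra.

Set Implicit Arguments.
Unset Strict Implicit.
Unset Printing Implicit Defensive.

Import Order.TTheory GRing.Theory Num.Theory.
Import numFieldNormedType.Exports.

Local Open Scope classical_set_scope.
Local Open Scope ring_scope.

(** * Positive definite matrices *)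

Section positive_definite.
Variable R : realType.

Definition posdef n (M : 'M[R]_n) :=
  M^T = M /\ forall u : 'rV[R]_n, u != 0 -> 0 < (u *m M *m u^T) 0 0.

Lemma posdef_congr n (M B : 'M[R]_n) :
  B \in unitmx -> posdef M -> posdef (B *m M *m B^T).
Proof.
move=> uB [symM posM]; split.
  by rewrite !trmx_mul trmxK symM mulmxA.
move=> u u0; have uB0 : u *m B != 0.
  by apply: contraNneq u0 => uB0; rewrite -(mulmxK uB u) uB0 mul0mx.
by have := posM _ uB0; rewrite trmx_mul !mulmxA.
Qed.

Lemma posdef_drsub n (M : 'M[R]_(1 + n)) : posdef M -> posdef (drsubmx M).
Proof.
move=> [symM posM]; split; first by rewrite trmx_drsub symM.
move=> u u0; have v0 : row_mx 0 u != 0 :> 'rV[R]_(1 + n).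
  by rewrite row_mx_eq0 negb_and u0 orbT.
have := posM _ v0; rewrite -{1}(submxK M) mul_row_block !mul0mx !add0r.
by rewrite tr_row_mx mul_row_col trmx0 mulmx0 add0r.
Qed.

Lemma posdef_diag_gt0 n (M : 'M[R]_n) i : posdef M -> 0 < M i i.
Proof.
move=> [_ posM]; have : delta_mx 0 i != 0 :> 'rV[R]_n.
  apply/eqP => /matrixP/(_ 0 i); rewrite !mxE !eqxx => /eqP.
  by rewrite oner_eq0.
move/posM; rewrite -rowE trmx_delta -colE.
by rewrite !mxE.
Qed.

(** One step of symmetric Gaussian elimination as a unit lower triangular block matrix, so that
    congruence by it preserves the determinant. *)
Definition schur_elim n (M : 'M[R]_(1 + n)) : 'M[R]_(1 + n) :=
  block_mx 1%:M 0 (- (M 0 0)^-1 *: dlsubmx M) 1%:M.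

Definition schur_compl n (M : 'M[R]_(1 + n)) : 'M[R]_n :=
  drsubmx M - (M 0 0)^-1 *: (dlsubmx M *m ursubmx M).

Lemma det_schur_elim n (M : 'M[R]_(1 + n)) : \det (schur_elim M) = 1.
Proof. by rewrite det_lblock !det1 mulr1. Qed.

(** Left multiplication clears the first column below the pivot; by symmetry of [M] the transposed
    factor on the right clears the first row. *)
Lemma schur_elimE n (M : 'M[R]_(1 + n)) : posdef M ->
  schur_elim M *m M *m (schur_elim M)^T =
  block_mx (M 0 0)%:M 0 0 (schur_compl M).
Proof.
move=> pM; have a0 := posdef_diag_gt0 0 pM.
have ulE : ulsubmx M = (M 0 0)%:M.
  apply/matrixP => i j; rewrite !ord1 !mxE eqxx mulr1n.
  by congr (M _ _); apply: val_inj.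
have [symM _] := pM.
have dlE : (dlsubmx M)^T = ursubmx M by rewrite -{1}symM trmx_dlsub trmxK.
set L := schur_elim M; rewrite -[X in L *m X *m _](submxK M) ulE.
rewrite /L /schur_elim /schur_compl tr_block_mx !mulmx_block.
rewrite !trmx1 !trmx0 !mul1mx !mul0mx !mulmx1 !mulmx0 !addr0.
rewrite -scalemxAl mul_mx_scalar scalerA mulNr mulVf ?gt_eqF// scaleN1r addNr.
rewrite mul0mx add0r linearZ/= dlE -scalemxAr mul_scalar_mx scalerA mulNr.
by rewrite mulVf ?gt_eqF// scaleN1r addNr -scalemxAl scaleNr addrC.
Qed.

(** The Schur complement is the lower right block of a matrix congruent to [M]. *)
Lemma posdef_schur n (M : 'M[R]_(1 + n)) : posdef M -> posdef (schur_compl M).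
Proof.
move=> pM.
rewrite -(@block_mxKdr _ 1 n 1 n (M 0 0)%:M 0 0 (schur_compl M)) -schur_elimE//;
  apply: posdef_drsub; apply: posdef_congr => //.
by rewrite unitmxE det_schur_elim unitr1.
Qed.

Lemma det_schur n (M : 'M[R]_(1 + n)) : posdef M ->
  \det M = M 0 0 * \det (schur_compl M).
Proof.
move=> pM; have := congr1 determinant (schur_elimE pM).
by rewrite !det_mulmx det_tr det_schur_elim mul1r mulr1 => ->;
  rewrite det_ublock det_scalar1.
Qed.

(** Induction through [det_schur]: by symmetry, passing to the Schur complement subtracts a
    nonnegative multiple of a square from each remaining diagonal entry. *)
Lemma hadamard_det n (M : 'M[R]_n) :
  posdef M -> 0 < \det M <= \prod_i M i i.
Proof.
elim: n M => [|n IHn] M pM; first by rewrite det_mx00 big_ord0 ltr01 lexx.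
have a0 := posdef_diag_gt0 0 pM.
have /andP[S0 leS] := IHn _ (posdef_schur pM).
rewrite (det_schur (n := n) pM) mulr_gt0//=.
rewrite big_ord_recl ler_pM2l//; apply: (le_trans leS).
apply: ler_prod => i _; rewrite ltW ?(posdef_diag_gt0 _ (posdef_schur pM)) //=.
have dlE : dlsubmx (M : 'M[R]_(1 + n)) i 0 = ursubmx (M : 'M[R]_(1 + n)) 0 i.
  by have [symM _] := pM; rewrite -{1}symM !mxE.
have -> : M (lift ord0 i) (lift ord0 i) = drsubmx (M : 'M[R]_(1 + n)) i i.
  by rewrite !mxE; congr (M _ _); apply: val_inj.
rewrite /schur_compl [leLHS]mxE [X in _ + X <= _]mxE.
rewrite [X in _ - X <= _]mxE [X in _ - _ * X <= _]mxE.
rewrite big_ord1 dlE gerBl mulr_ge0 ?invr_ge0 ?(ltW a0)//.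
by rewrite -expr2 sqr_ge0.
Qed.

(** Iterated elimination replaces the spectral theorem: [U] only has to have determinant one, not to
    be orthogonal. *)
Lemma posdef_diagonalizable n (M : 'M[R]_n) : posdef M ->
  exists (U : 'M[R]_n) (d : 'rV[R]_n),
    [/\ \det U = 1, forall i, 0 < d 0 i & U *m M *m U^T = diag_mx d].
Proof.
elim: n M => [|n IHn] M pM.
  exists 1%:M, 0; split; first by rewrite det1.
    by case.
  by apply/matrixP; case.
have [U [d [dU d0 UE]]] := IHn _ (posdef_schur pM).
pose B : 'M[R]_(1 + n) := block_mx 1%:M 0 0 U.
exists (B *m schur_elim M), (row_mx (M 0 0)%:M d : 'rV[R]_(1 + n)); split.
- by rewrite (det_mulmx B) det_schur_elim /B det_ublock det1 dU !mulr1.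
- move=> i; rewrite mxE; case: splitP => j _ //.
  by rewrite !ord1 mxE eqxx mulr1n posdef_diag_gt0.
- rewrite trmx_mul !mulmxA.
  have -> : B *m schur_elim M *m M *m (schur_elim M)^T *m B^T =
            B *m (schur_elim M *m M *m (schur_elim M)^T) *m B^T.
    by rewrite !mulmxA.
  rewrite schur_elimE// /B tr_block_mx !mulmx_block.
  rewrite !trmx1 !trmx0 !mul1mx !mul0mx !mulmx1 !mulmx0 !addr0 !add0r !mul0mx UE.
  rewrite [RHS](@diag_mx_row _ n 1).
  suff <- : (M 0 0)%:M = diag_mx (M 0 0)%:M :> 'M[R]_1 by [].
  by apply/matrixP => i j; rewrite !ord1 !mxE.
Qed.

(** After diagonalization, scaling coordinate [i] by [sqrt (c / d_i)], with [c] the geometric mean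
    of the [d_i], makes all diagonal entries equal; these scalings have product one. This is the
    equality case of Hadamard and AM-GM. *)
Lemma posdef_isotropic n (M : 'M[R]_n) : posdef M ->
  exists (A : 'M[R]_n) (c : R), \det A = 1 /\ A *m M *m A^T = c%:M.
Proof.
move=> /posdef_diagonalizable[U [d [dU d0 UE]]].
have [n0|n0] := posnP n.
  by subst n; exists 1%:M, 0; split; [rewrite det1|apply/matrixP; case].
pose p := \prod_i d 0 i; have p0 : 0 < p by apply: prodr_gt0.
pose c := p `^ n%:R^-1; have c0 : 0 < c by apply: powR_gt0.
have cn : c ^+ n = p.
  by rewrite -powR_mulrn ?ltW// -powRrM mulVf ?powRr1 ?ltW// pnatr_eq0 -lt0n.
pose e : 'rV[R]_n := \row_i Num.sqrt (c / d 0 i).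
have eE i : e 0 i ^+ 2 = c / d 0 i.
  by rewrite mxE sqr_sqrtr// divr_ge0 ?ltW.
exists (diag_mx e *m U), c; split.
  rewrite det_mulmx dU mulr1 det_diag.
  apply: (@pexpIrn _ 2); rewrite ?nnegrE// ?ler01//.
    by apply: prodr_ge0 => i _; rewrite mxE sqrtr_ge0.
  rewrite expr1n -prodrXl; under eq_bigr do rewrite eE.
  by rewrite big_split/= prodr_const card_ord cn prodfV mulfV// gt_eqF.
rewrite trmx_mul tr_diag_mx -(mulmxA (diag_mx e)) -(mulmxA (diag_mx e)).
rewrite (mulmxA (U *m M)) UE; apply/matrixP => i j.
rewrite mul_diag_mx mxE mul_mx_diag !mxE; case: eqVneq => [<-|_].
  rewrite !mulr1n mulrCA -expr2 sqr_sqrtr ?divr_ge0 ?ltW//.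
  by rewrite mulrC divfK// gt_eqF.
by rewrite /= !mulr0n mul0r mulr0.
Qed.

(** Congruence by [A] keeps the determinant; Hadamard bounds it by the diagonal product, and AM-GM
    bounds that product by the trace. *)
Lemma det_le_trace_congr n (M A : 'M[R]_n) : posdef M -> \det A = 1 ->
  \det M <= (\tr (A *m M *m A^T) / n%:R) ^+ n.
Proof.
move=> pM dA; have uA : A \in unitmx by rewrite unitmxE dA unitr1.
have pB := posdef_congr uA pM.
have /andP[_] := hadamard_det pB.
rewrite !det_mulmx det_tr dA mul1r mulr1 => /le_trans; apply.
have := @leif_AGM _ _ (mem 'I_n) (fun i => (A *m M *m A^T) i i).
rewrite card_ord => /(_ _)[]// i _.
by rewrite ltW ?posdef_diag_gt0.
Qed.

End positive_definite.

(** * Trimming on a probability space *)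

Section probability_integral.
Context d (T : measurableType d) (R : realType) (P : probability T R).
Implicit Types (f g q psi : T -> R) (A : set T).

Lemma bounded_integrable f M : measurable_fun setT f ->
  (forall x, `|f x| <= M) -> P.-integrable setT (EFin \o f).
Proof.
move=> mf fM; apply: measurable_bounded_integrable => //.
  by rewrite -ge0_fin_numE// fin_num_measure.
exists M; split; first exact: num_real.
by move=> y My x _; apply: (le_trans (fM x)); exact: ltW.
Qed.

Lemma unit_integrable psi : measurable_fun setT psi ->
  (forall x, 0 <= psi x <= 1) -> P.-integrable setT (EFin \o psi).
Proof.
move=> mpsi psi01; apply: (@bounded_integrable _ 1) => // x.
by have /andP[? ?] := psi01 x; rewrite ger0_norm.
Qed.

Lemma Rintegral_le1 psi : measurable_fun setT psi ->
  (forall x, 0 <= psi x <= 1) -> \int[P]_x psi x <= 1.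
Proof.
move=> mpsi psi01; have P1 : \int[P]_x 1 = 1.
  rewrite Rintegral_cst// mul1r; exact: (congr1 fine (probability_setT P)).
rewrite -[leRHS]P1; apply: le_Rintegral => //; first exact: unit_integrable.
  by apply: (@bounded_integrable _ 1) => // x; rewrite normr1.
by move=> x _; have /andP[] := psi01 x.
Qed.

Lemma Rintegral_sum_seq (I : Type) (s : seq I) (F : I -> T -> R) :
  (forall i, P.-integrable setT (EFin \o F i)) ->
  P.-integrable setT (EFin \o (fun x => \sum_(i <- s) F i x)) /\
  \int[P]_x (\sum_(i <- s) F i x) = \sum_(i <- s) \int[P]_x F i x.
Proof.
move=> iF; elim: s => [|i s [IHi IHs]].
  split.
    by under [X in EFin \o X]eq_fun do rewrite big_nil; exact: integrable0.
  rewrite big_nil; under eq_Rintegral do rewrite big_nil.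
  by rewrite Rintegral_cst// mul0r.
split.
  under eq_fun do rewrite big_cons.
  exact: (integrableD measurableT (iF i) IHi).
under eq_Rintegral do rewrite big_cons.
by rewrite RintegralD// big_cons IHs.
Qed.

Lemma bigcup_probability_le (F : (set T)^nat) (a : \bar R) :
  (forall n, measurable (F n)) -> nondecreasing_seq F ->
  (forall n, P (F n) <= a)%E -> (P (\bigcup_n F n) <= a)%E.
Proof.
move=> mF ndF Fa; have mU : measurable (\bigcup_n F n) by exact: bigcup_measurable.
have cvgF := nondecreasing_cvg_mu (mu := P) mF mU ndF.
by apply: (cvge_to_le cvgF); apply: nearW.
Qed.

Lemma bigcap_probability_ge (F : (set T)^nat) (a : \bar R) :
  (forall n, measurable (F n)) -> nonincreasing_seq F ->
  (forall n, a <= P (F n))%E -> (a <= P (\bigcap_n F n))%E.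
Proof.
move=> mF niF aF; have mI : measurable (\bigcap_n F n) by exact: bigcap_measurable.
have F0 : (P (F 0%N) < +oo)%E by rewrite -ge0_fin_numE// fin_num_measure.
have cvgF := nonincreasing_cvg_mu F0 mF mI niF.
by apply: (cvge_to_ge cvgF); apply: nearW.
Qed.

Lemma measurable_sublevel q s : measurable_fun setT q ->
  measurable [set x | q x <= s] /\ measurable [set x | q x < s].
Proof.
move=> mq; split.
  rewrite (_ : mkset _ = setT `&` q @^-1` `]-oo, s]); first exact: mq.
  by rewrite setTI; apply/seteqP; split=> x /=; rewrite in_itv.
rewrite (_ : mkset _ = setT `&` q @^-1` `]-oo, s[); first exact: mq.
by rewrite setTI; apply/seteqP; split=> x /=; rewrite in_itv.
Qed.

(** Take [s] as the infimum of the levels whose closed sublevel set has mass at least [gamma].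
    Continuity of [P] from below gives the bound on [q < s], continuity from above the one on
    [q <= s]. The bound [gamma < 1] makes the set of levels nonempty, and [0 < gamma] bounds it
    below by zero. *)
Lemma quantile q (gamma : R) : measurable_fun setT q -> (forall x, 0 <= q x) ->
  0 < gamma < 1 ->
  exists s : R, [/\ 0 <= s, (P [set x | (q x < s)%R] <= gamma%:E)%E &
                (gamma%:E <= P [set x | (q x <= s)%R])%E].
Proof.
move=> mq q0 /andP[g0 g1].
have mle s := (measurable_sublevel s mq).1.
have ndle (s s' : R) : s <= s' -> [set x | q x <= s] `<=` [set x | q x <= s'].
  by move=> ss' x /= /le_trans; apply.
pose S := [set s | (gamma%:E <= P [set x | (q x <= s)%R])%E].
have S_ge0 s : S s -> 0 <= s.
  rewrite leNgt => Ss; apply/negP => s0; move: Ss; rewrite /S/=.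
  rewrite (_ : mkset _ = set0) ?measure0 ?lee_fin ?leNgt ?g0//.
  apply/seteqP; split=> x //= qs; have := le_lt_trans qs s0.
  by rewrite ltNge q0.
have S0 : S !=set0.
  apply: contrapT => /set0P/negP; rewrite negbK => /eqP Se.
  have : (P (\bigcup_n [set x | (q x <= n%:R)%R]) <= gamma%:E)%E.
    apply: bigcup_probability_le => //.
      move=> n m nm; apply/subsetPset; apply: ndle.
      by rewrite ler_nat.
    move=> n; rewrite leNgt; apply/negP => /ltW Sn.
    by have : S n%:R by []; rewrite Se.
  rewrite (_ : \bigcup_n _ = setT) ?probability_setT ?lee_fin ?leNgt ?g1//.
  apply/seteqP; split=> x //= _; exists (Num.trunc (q x)).+1 => //=.
  by rewrite ltW// truncnS_gt.
have infS : has_inf S by split=> //; exists 0 => s /S_ge0.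
exists (inf S); split; first exact: lb_le_inf.
- rewrite (_ : mkset _ = \bigcup_n [set x | q x <= inf S - n.+1%:R^-1]).
    apply: bigcup_probability_le => //.
      move=> n m nm; apply/subsetPset; apply: ndle.
      by rewrite lerD2l lerN2 lef_pV2 ?posrE// ler_nat.
    move=> n; rewrite leNgt; apply/negP => /ltW Sn.
    have := ge_inf infS.2 (Sn : S _).
    by rewrite lerBrDr gerDl leNgt invr_gt0 ltr0Sn.
  apply/seteqP; split=> x /=.
    rewrite -subr_gt0 => e0; exists (Num.trunc (inf S - q x)^-1) => //=.
    rewrite lerBrDl -lerBrDr invf_ple ?posrE// ?ltr0Sn//.
    by rewrite ltW// truncnS_gt.
  by move=> [n _ /= /le_lt_trans]; apply; rewrite ltrBlDr ltrDl invr_gt0 ltr0Sn.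
- rewrite (_ : mkset _ = \bigcap_n [set x | q x <= inf S + n.+1%:R^-1]).
    apply: bigcap_probability_ge => //.
      move=> n m nm; apply/subsetPset; apply: ndle.
      by rewrite lerD2l lef_pV2 ?posrE// ler_nat.
    move=> n; have n0 : 0 < n.+1%:R^-1 :> R by rewrite invr_gt0 ltr0Sn.
    have [s Ss sn] := inf_adherent n0 infS.
    apply: (le_trans Ss); apply: le_measure; rewrite ?inE//.
    exact/ndle/ltW.
  apply/seteqP; split=> x /= => [qx n _ /=|qx].
    by rewrite (le_trans qx)// lerDl invr_ge0.
  apply/ler_addgt0Pr => e e0; have := qx (Num.trunc e^-1) I.
  move=> /= /le_trans; apply; rewrite lerD2l invf_ple ?posrE ?ltr0Sn//.
  by rewrite ltW// truncnS_gt.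
Qed.

(* Lagrangian bound for minimizing the integral of q psi under a constraint on
   the integral of psi, with multiplier s. *)
Lemma trimmed_integral_ge q psi s :
  measurable_fun setT q -> (forall x, 0 <= q x) -> 0 <= s ->
  measurable_fun setT psi -> (forall x, 0 <= psi x <= 1) ->
  P.-integrable setT (EFin \o (fun x => q x * psi x)) ->
  s * \int[P]_x psi x - \int[P]_x Num.max (s - q x) 0 <= \int[P]_x (q x * psi x).
Proof.
move=> mq q0 s0 mpsi psi01 iqpsi.
have ipsi : P.-integrable setT (EFin \o psi).
  exact: unit_integrable.
have imax : P.-integrable setT (EFin \o (fun x => Num.max (s - q x) 0)).
  apply: (@bounded_integrable _ s).
    by apply: measurable_maxr => //; apply: measurable_funB.
  move=> x; rewrite ger0_norm ?le_max ?lexx ?orbT// ge_max s0 andbT.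
  by rewrite gerBl.
rewrite -RintegralZl// -RintegralB//; last first.
  by have := integrableZl measurableT s ipsi.
apply: le_Rintegral => //.
  have /= h1 := integrableZl measurableT s ipsi.
  by have := integrableB measurableT h1 imax.
move=> x _; have /andP[p0 p1] := psi01 x.
rewrite lerBlDr -lerBlDl -mulrBl le_max; have [sq|/ltW sq] := leP 0 (s - q x).
  by rewrite ler_piMr.
by rewrite mulr_le0_ge0 ?orbT.
Qed.

(** With the quantile [s] as multiplier, [phi] is one where [q < s], a constant fraction where
    [q = s], and zero beyond, so it attains the Lagrangian bound. The mass bound on [q < s] is kept
    in the conclusion in order to bound [s] later. *)
Lemma optimal_trimming q (gamma : R) : measurable_fun setT q ->
  (forall x, 0 <= q x) -> 0 < gamma < 1 ->
  exists (s : R) (phi : T -> R), [/\ measurable_fun setT phi, forall x, 0 <= phi x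
    <= 1 &
    \int[P]_x phi x = gamma] /\ [/\ (P [set x | (q x < s)%R] <= gamma%:E)%E,
    forall x, phi x != 0 -> q x <= s &
    forall psi, measurable_fun setT psi -> (forall x, 0 <= psi x <= 1) ->
      gamma <= \int[P]_x psi x ->
      P.-integrable setT (EFin \o (fun x => q x * psi x)) ->
      gamma^-1 * \int[P]_x (q x * phi x) <=
        (\int[P]_x psi x)^-1 * \int[P]_x (q x * psi x)].
Proof.
move=> mq q0 g01; have [s [s0 lts les]] := quantile mq q0 g01.
have /andP[g0 g1] := g01.
have [mle mlt] := measurable_sublevel s mq.
pose L := [set x | q x < s]; pose E := [set x | q x <= s] `\` L.
have mE : measurable E by apply: measurableD.
have LE : L `|` E = [set x | q x <= s].
  by apply: setDUK => x /= /ltW.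
have PLE : P [set x | q x <= s] = (P L + P E)%E.
  rewrite -LE measureU//; apply/seteqP; split=> x //=.
  by case=> ? [].
pose l := fine (P L); pose e := fine (P E).
have lE : P L = l%:E by rewrite fineK// fin_num_measure.
have eE : P E = e%:E by rewrite fineK// fin_num_measure.
move: lts les; rewrite PLE lE eE -EFinD !lee_fin => lg gle.
have e0 : 0 <= e by rewrite fine_ge0.
(* The fraction of the level set [q = s] that brings the mass to exactly [gamma]. If [e = 0] the
   quotient is 0 by convention, and then [l = gamma] already. *)
pose lam := (gamma - l) / e.
have lam01 : 0 <= lam <= 1.
  have := e0; rewrite /lam le_eqVlt => /predU1P[<-|e1].
    by rewrite invr0 mulr0 lexx ler01.
  by rewrite divr_ge0 ?subr_ge0//= ler_pdivrMr// mul1r lerBlDl.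
have lame : lam * e = gamma - l.
  have := e0; rewrite /lam le_eqVlt => /predU1P[e1|e1].
    by rewrite -e1 mulr0; apply/esym/eqP; rewrite subr_eq0 eq_le lg andbT;
      move: gle; rewrite -e1 addr0.
  by rewrite divfK// gt_eqF.
have /andP[lam0 lam1] := lam01.
pose phi x := \1_L x + lam * \1_E x.
have phiL x : q x < s -> phi x = 1.
  move=> qs; rewrite /phi !indicE (mem_set (qs : L x)) memNset ?mulr0 ?addr0//.
  by case.
have phiE x : q x = s -> phi x = lam.
  move=> qs; have nL : ~ L x by rewrite /L/= qs ltxx.
  rewrite /phi !indicE (memNset nL) mem_set ?mulr1 ?add0r//.
  by split=> //=; rewrite qs.
have phiG x : s < q x -> phi x = 0.
  move=> qs; have nL : ~ L x by rewrite /L/= ltNge ltW.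
  rewrite /phi !indicE (memNset nL) memNset ?mulr0 ?addr0//.
  by move=> [/=]; rewrite leNgt qs.
have phi01 x : 0 <= phi x <= 1.
  by have [/phiL->|/phiG->|/phiE->] := ltgtP (q x) s; rewrite ?lexx ?ler01.
have mL1 : measurable_fun setT (\1_L : T -> R) by exact: measurable_indic.
have mE1 : measurable_fun setT (\1_E : T -> R) by exact: measurable_indic.
have mphi : measurable_fun setT phi.
  by apply: measurable_funD => //; exact: measurable_funM.
have iphi : \int[P]_x phi x = gamma.
  have iL := integrable_indic P mlt; have iE := integrable_indic P mE.
  rewrite /phi RintegralD//; last exact: (integrableZl measurableT lam iE).
  rewrite RintegralZl// /Rintegral !integral_indic// !setIT -/l -/e lame.
  by rewrite addrC subrK.
have qphis x : 0 <= q x * phi x <= s.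
  have /andP[p0 p1] := phi01 x; rewrite mulr_ge0//=.
  have [/ltW qs|/phiG->|qs] := ltgtP (q x) s; last 2 first.
  - by rewrite mulr0.
  - by rewrite -qs ler_piMr.
  - by rewrite (le_trans _ qs)// ler_piMr.
have mqphi : measurable_fun setT (fun x => q x * phi x) by exact: measurable_funM.
have imax : P.-integrable setT (EFin \o (fun x => Num.max (s - q x) 0)).
  apply: (@bounded_integrable _ s).
    by apply: measurable_maxr => //; apply: measurable_funB.
  move=> x; rewrite ger0_norm ?le_max ?lexx ?orbT// ge_max s0 andbT.
  by rewrite gerBl.
exists s, phi; split; split=> //; first by rewrite lE lee_fin.
  by move=> x; apply: contraNT; rewrite -ltNge => /phiG ->.
move=> psi mpsi psi01 gpsi iqpsi.
have m0 : 0 < \int[P]_x psi x by apply: lt_le_trans gpsi.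
have := trimmed_integral_ge mq q0 s0 mpsi psi01 iqpsi.
(* Equality in the duality bound holds pointwise: [q phi = s phi - max (s - q) 0]. *)
have -> : \int[P]_x (q x * phi x) = s * gamma - \int[P]_x Num.max (s - q x) 0.
  have iphi' : P.-integrable setT (EFin \o phi).
    exact: unit_integrable.
  rewrite -iphi -RintegralZl// -RintegralB//;
    last exact: (integrableZl measurableT s iphi').
  apply: eq_Rintegral => x _; apply/eqP;
    rewrite eq_sym subr_eq addrC -subr_eq -mulrBl; apply/eqP.
  have [qs|qs|qs] := ltgtP (q x) s.
  - by rewrite (phiL _ qs) mulr1; apply/esym/max_idPl; rewrite subr_ge0 ltW.
  - by rewrite (phiG _ qs) mulr0; apply/esym/max_idPr; rewrite subr_le0 ltW.
  - by rewrite qs subrr mul0r maxxx.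
set h := \int[P]_x Num.max _ _; have h0 : 0 <= h.
  by apply: Rintegral_ge0 => x _; rewrite le_max lexx orbT.
move: (\int[P]_x psi x) (\int[P]_x (q x * psi x)) m0 gpsi => m I m0 gm mI.
rewrite -(ler_pM2l m0) mulVKf ?gt_eqF//; apply: le_trans mI.
(* The two averages compare as [s - h / gamma] against at least [s - h / m]; here [h >= 0] and
   [gamma <= m], so excess mass does not help. *)
have -> : m * (gamma^-1 * (s * gamma - h)) = s * m - m * gamma^-1 * h.
  by field; rewrite gt_eqF.
by rewrite lerD2l lerN2 ler_peMl// ler_pdivlMr// mul1r.
Qed.

End probability_integral.

(** * Affine forms and trimmed moments *)

Section real_valued_continuity.
Variables (X : topologicalType) (R : realType).
Implicit Types f g : X -> R.

Lemma continuous_add f g :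
  continuous f -> continuous g -> continuous (fun x => f x + g x).
Proof. by move=> cf cg x; apply: cvgD; [exact: cf|exact: cg]. Qed.

Lemma continuous_mul f g :
  continuous f -> continuous g -> continuous (fun x => f x * g x).
Proof. by move=> cf cg x; apply: cvgM; [exact: cf|exact: cg]. Qed.

Lemma continuous_sum_seq (I : Type) (s : seq I) (F : I -> X -> R) :
  (forall i, continuous (F i)) -> continuous (fun x => \sum_(i <- s) F i x).
Proof.
move=> cF; elim: s => [|i s IHs].
  under eq_fun do rewrite big_nil.
  exact: cst_continuous.
under eq_fun do rewrite big_cons.
exact: continuous_add.
Qed.

Lemma continuous_sqrt_comp f : continuous f -> continuous (fun x => Num.sqrt (f x)).
Proof.
by move=> cf x; apply: continuous_comp; [exact: cf|exact: sqrt_continuous].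
Qed.

End real_valued_continuity.

Section affine_forms.
Variables (R : realType) (k : nat).
Implicit Types (x : 'rV[R]_k) (w : 'rV[R]_(k + 1)).

(** Linear part and constant share one row vector, so that a pair [(A, b)] becomes a single matrix
    with one affine form per row. *)
Definition aff w x : R :=
  \sum_(i < k) w 0 (lshift 1 i) * x 0 i + w 0 (rshift k 0).

Lemma affB w w' x : aff (w - w') x = aff w x - aff w' x.
Proof.
rewrite /aff !mxE opprD addrACA -sumrB; congr (_ + _).
by apply: eq_bigr => i _; rewrite !mxE mulrBl.
Qed.

Lemma affZ a w x : aff (a *: w) x = a * aff w x.
Proof.
rewrite /aff !mxE mulrDr mulr_sumr; congr (_ + _).
by apply: eq_bigr => i _; rewrite !mxE mulrA.
Qed.

Lemma aff_row_mx (u : 'rV[R]_k) (b : 'rV[R]_1) x :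
  aff (row_mx u b) x = \sum_i u 0 i * x 0 i + b 0 0.
Proof.
by rewrite /aff row_mxEr; congr (_ + _); apply: eq_bigr => i _; rewrite row_mxEl.
Qed.

Lemma affE_center w x (t : 'rV[R]_k) :
  aff w x = \sum_i w 0 (lshift 1 i) * (x 0 i - t 0 i) + aff w t.
Proof.
rewrite /aff addrA -big_split/=; congr (_ + _).
by apply: eq_bigr => i _; rewrite -mulrDr subrK.
Qed.

Lemma aff_continuous w : continuous (aff w).
Proof.
apply: continuous_add; last exact: cst_continuous.
apply: continuous_sum_seq => i; apply: continuous_mul.
  exact: cst_continuous.
exact: coord_continuous.
Qed.

(* The Euclidean norm of (x, 1). *)
Definition lift_norm x : R := Num.sqrt (1 + \sum_i x 0 i ^+ 2).

Lemma lift_norm_arg_ge1 x : 1 <= 1 + \sum_i x 0 i ^+ 2.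
Proof. by rewrite lerDl; apply: sumr_ge0 => i _; exact: sqr_ge0. Qed.

Lemma lift_norm_ge1 x : 1 <= lift_norm x.
Proof. by rewrite -(sqrtr1 R) ler_sqrt ?lift_norm_arg_ge1// (le_trans ler01
  (lift_norm_arg_ge1 x)). Qed.

Lemma lift_norm_gt0 x : 0 < lift_norm x.
Proof. exact: lt_le_trans ltr01 (lift_norm_ge1 x). Qed.

Lemma lift_norm_sqr x : lift_norm x ^+ 2 = 1 + enorm x ^+ 2.
Proof.
rewrite /lift_norm /enorm !sqr_sqrtr//.
  by apply: sumr_ge0 => i _; exact: sqr_ge0.
exact: le_trans ler01 (lift_norm_arg_ge1 x).
Qed.

Lemma lift_norm_continuous : continuous lift_norm.
Proof.
apply: continuous_sqrt_comp; apply: continuous_add.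
  exact: cst_continuous.
apply: continuous_sum_seq => i.
by apply: continuous_mul; exact: coord_continuous.
Qed.

Lemma coord_le_lift_norm x i : `|x 0 i| <= lift_norm x.
Proof.
rewrite -sqrtr_sqr ler_sqrt; last exact: le_trans ler01 (lift_norm_arg_ge1 x).
rewrite (bigD1 i)//= addrCA lerDl addr_ge0//.
by apply: sumr_ge0 => j _; exact: sqr_ge0.
Qed.

Lemma mx_entry_le_norm m n (A : 'M[R]_(m, n)) i j : `|A i j| <= `|A|.
Proof.
rewrite [leRHS]/Num.norm /= mx_normrE.
by apply/bigmax_geP; right; exists (i, j).
Qed.

(** Each of the [k + 1] terms is at most the sup norm of [w] times the Euclidean norm of
    [(x, 1)]. *)
Lemma aff_le w x : `|aff w x| <= k.+1%:R * `|w| * lift_norm x.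
Proof.
have N1 := lift_norm_ge1 x; have N0 := ltW (lift_norm_gt0 x).
rewrite /aff (le_trans (ler_normD _ _))// -natr1 mulrDl mul1r mulrDl lerD//.
  rewrite (le_trans (ler_norm_sum _ _ _))//.
  rewrite -mulrA mulr_natl -[X in _ *+ X](card_ord k) -sumr_const.
  apply: ler_sum => i _; rewrite normrM ler_pM//.
    exact: mx_entry_le_norm.
  exact: coord_le_lift_norm.
rewrite (le_trans (mx_entry_le_norm w _ _))// ler_peMr//.
Qed.

Lemma aff_mul_le w w' x : `|aff w x * aff w' x| <=
  k.+1%:R ^+ 2 * `|w| * `|w'| * lift_norm x ^+ 2.
Proof.
rewrite normrM (le_trans (ler_pM _ _ (aff_le w x) (aff_le w' x)))//.
by rewrite le_eqVlt; apply/orP; left; apply/eqP; ring.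
Qed.

Lemma enorm_continuous : continuous (@enorm R k).
Proof.
apply: continuous_sqrt_comp; apply: continuous_sum_seq => i.
by apply: continuous_mul; exact: coord_continuous.
Qed.

Lemma continuous_borelRV_measurable (f : 'rV[R]_k -> R) : continuous f ->
  measurable_fun [set: borelRV R k] (f : borelRV R k -> R).
Proof.
move=> /continuousP cf; apply: (measurability _ (RGenOpens.measurableE R)).
move=> _ [_ [a [b ->] <-]]; rewrite setTI; apply: sub_sigma_algebra.
exact/cf/interval_open.
Qed.

Lemma enorm_measurable :
  measurable_fun [set: borelRV R k] (@enorm R k : borelRV R k -> R).
Proof. by apply: continuous_borelRV_measurable; exact: enorm_continuous. Qed.

Lemma enorm_ball_measurable r : measurable (enorm_ball r : set (borelRV R k)).
Proof. exact: (measurable_sublevel r enorm_measurable).1. Qed.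

Lemma aff_measurable w :
  measurable_fun [set: borelRV R k] (aff w : borelRV R k -> R).
Proof. apply: continuous_borelRV_measurable; exact: aff_continuous. Qed.

Lemma aff_mul_measurable w w' :
  measurable_fun [set: borelRV R k]
    ((fun x => aff w x * aff w' x) : borelRV R k -> R).
Proof. by apply: measurable_funM; exact: aff_measurable. Qed.

End affine_forms.

(** * Second moments of affine forms under a trimming function *)

Section trimmed_moments.
Context (R : realType) (k : nat) (P : probability (borelRV R k) R).
Variables (gamma : R) (phi : borelRV R k -> R).
Hypotheses (gamma_gt0 : 0 < gamma) (tphi : trim_class P gamma phi).

Lemma trim_class_integrable : P.-integrable setT (EFin \o phi).
Proof.
have [mphi phi01 _ _] := tphi.
apply: (@bounded_integrable _ _ _ _ _ 1) => // x; have /andP[? ?] := phi01 x.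
by rewrite ger0_norm.
Qed.

Lemma trim_mass_ge : gamma <= trim_mass P phi.
Proof.
have [_ _ gphi _] := tphi; rewrite -lee_fin /trim_mass /Rintegral fineK//.
exact: integrable_fin_num trim_class_integrable.
Qed.

Lemma trim_mass_gt0 : 0 < trim_mass P phi.
Proof. exact: lt_le_trans trim_mass_ge. Qed.

Lemma trim_mass_le1 : trim_mass P phi <= 1.
Proof.
have [mphi phi01 _ _] := tphi.
exact: Rintegral_le1.
Qed.

(** The product is dominated by [|C| (1 + enorm x ^+ 2) phi x], and the trimming class makes both
    summands integrable. *)
Lemma trim_integrable (f : borelRV R k -> R) C : measurable_fun setT f ->
  (forall x, `|f x| <= C * lift_norm x ^+ 2) ->
  P.-integrable setT (EFin \o (fun x => f x * phi x)).
Proof.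
move=> mf fC; have [mphi phi01 _ fin2] := tphi.
have i2 : P.-integrable setT (EFin \o (fun x => enorm x ^+ 2 * phi x)).
  apply/integrableP; split.
    apply/measurable_EFinP/measurable_funM => //; apply: measurable_funX.
    exact: enorm_measurable.
  under eq_integral => x _.
    rewrite gee0_abs; last by rewrite lee_fin mulr_ge0 ?sqr_ge0//;
      case/andP: (phi01 x).
    over.
  exact: fin2.
have i3 : P.-integrable setT (EFin \o (fun x => `|C| * (phi x + enorm x ^+ 2 * phi
  x))).
  have h1 := integrableD measurableT trim_class_integrable i2.
  exact: (integrableZl measurableT `|C| h1).
apply: le_integrable i3 => //.
  by apply/measurable_EFinP/measurable_funM.
move=> x _ /=; have /andP[p0 p1] := phi01 x.
rewrite lee_fin [leRHS]ger0_norm; last first.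
  by rewrite mulr_ge0// addr_ge0// mulr_ge0// sqr_ge0.
have -> : phi x + enorm x ^+ 2 * phi x = lift_norm x ^+ 2 * phi x.
  by rewrite lift_norm_sqr mulrDl mul1r.
rewrite normrM (ger0_norm p0) mulrA.
rewrite ler_wpM2r// (le_trans (fC x))// ler_wpM2r ?sqr_ge0//.
exact: ler_norm.
Qed.

Lemma aff_mul_integrable w w' :
  P.-integrable setT (EFin \o (fun x => (aff w x * aff w' x) * phi x)).
Proof. by apply: trim_integrable (aff_mul_measurable w w') (aff_mul_le w w'). Qed.

Let T := trim_mean P phi.
(** [cw i] is the coordinate [i] centred at the trimmed mean, [one] the constant form 1. Multiplying
    by [one] brings first moments under [aff_mul_integrable]. *)
Let cw i : 'rV[R]_(k + 1) := row_mx (delta_mx 0 i) (- (T 0 i))%:M.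
Let one : 'rV[R]_(k + 1) := row_mx 0 1%:M.

Let cwE i x : aff (cw i) x = x 0 i - T 0 i.
Proof.
rewrite aff_row_mx !mxE eqxx mulr1n; congr (_ + _).
rewrite (bigD1 i)//= mxE !eqxx mul1r big1 ?addr0// => j ji.
by rewrite mxE (negbTE ji) andbF mul0r.
Qed.

Let oneE x : aff one x = 1.
Proof.
rewrite aff_row_mx !mxE eqxx mulr1n big1 ?add0r// => i _.
by rewrite mxE mul0r.
Qed.

Let integral_centered i : \int[P]_x (aff (cw i) x * phi x) = 0.
Proof.
have ix : P.-integrable setT (EFin \o (fun x => (x : 'rV[R]_k) 0 i * phi x)).
  have := aff_mul_integrable (row_mx (delta_mx 0 i) 0) one.
  apply: eq_integrable => // x _ /=; rewrite oneE mulr1 aff_row_mx mxE addr0.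
  rewrite (bigD1 i)//= mxE !eqxx mul1r big1 ?addr0// => j ji.
  by rewrite mxE (negbTE ji) andbF mul0r.
under eq_Rintegral do rewrite cwE mulrBl.
rewrite RintegralB//; last exact: (integrableZl measurableT (T 0 i)
  trim_class_integrable).
rewrite RintegralZl//; last exact: trim_class_integrable.
rewrite -/(trim_mass P phi) /T /trim_mean !mxE mulrAC mulVf ?mul1r ?subrr//.
by rewrite gt_eqF// trim_mass_gt0.
Qed.

Lemma trim_covE i j : trim_cov P phi i j =
  (trim_mass P phi)^-1 * \int[P]_x (aff (cw i) x * aff (cw j) x * phi x).
Proof.
rewrite /trim_cov !mxE; congr (_ * _); apply: eq_Rintegral => x _.
by rewrite !cwE !mxE big_ord1 !mxE.
Qed.

Lemma trim_cov_sym : (trim_cov P phi)^T = trim_cov P phi.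
Proof.
apply/matrixP => i j; rewrite mxE !trim_covE; congr (_ * _).
by apply: eq_Rintegral => x _; rewrite [X in X * _]mulrC.
Qed.

(** Expand around the trimmed mean: the cross terms vanish by [integral_centered], leaving variance
    plus squared offset. *)
Lemma trim_second_moment w :
  (trim_mass P phi)^-1 * \int[P]_x (aff w x ^+ 2 * phi x) =
  (lsubmx w *m trim_cov P phi *m (lsubmx w)^T) 0 0 + aff w T ^+ 2.
Proof.
have m0 := trim_mass_gt0.
pose u i := w 0 (lshift 1 i); pose b := aff w T.
have affE x : aff w x ^+ 2 * phi x =
    \sum_i \sum_j (u i * u j) * (aff (cw i) x * aff (cw j) x * phi x) +
    (\sum_i (2 * b * u i) * (aff (cw i) x * phi x) + b ^+ 2 * phi x).
  rewrite (affE_center w x T) -/b.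
  under eq_bigr do rewrite -cwE.
  have -> : \sum_i \sum_j (u i * u j) * (aff (cw i) x * aff (cw j) x * phi x) =
    (\sum_i u i * aff (cw i) x) ^+ 2 * phi x.
    rewrite expr2 mulr_suml mulr_suml; apply: eq_bigr => i _.
    rewrite mulr_sumr mulr_suml; apply: eq_bigr => j _; ring.
  have -> : \sum_i (2 * b * u i) * (aff (cw i) x * phi x) =
    2 * b * (\sum_i u i * aff (cw i) x) * phi x.
    by rewrite mulr_sumr mulr_suml; apply: eq_bigr => j _; ring.
  by rewrite -/u; ring.
have i1 i j : P.-integrable setT (EFin \o (fun x => (u i * u j) * (aff (cw i) x *
  aff (cw j) x * phi x))).
  exact: (integrableZl measurableT (u i * u j) (aff_mul_integrable (cw i) (cw j))).
have i2 i : P.-integrable setT (EFin \o (fun x => aff (cw i) x * phi x)).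
  have := aff_mul_integrable (cw i) one.
  by apply: eq_integrable => // x _ /=; rewrite oneE mulr1.
have i3 i : P.-integrable setT (EFin \o (fun x => (2 * b * u i) * (aff (cw i) x *
  phi x))).
  exact: (integrableZl measurableT (2 * b * u i) (i2 i)).
have [i4 E4] := Rintegral_sum_seq (index_enum 'I_k) i3.
have i5 i := (Rintegral_sum_seq (index_enum 'I_k) (i1 i)).1.
have E5 i := (Rintegral_sum_seq (index_enum 'I_k) (i1 i)).2.
have [i6 E6] := Rintegral_sum_seq (index_enum 'I_k) i5.
have i7 : P.-integrable setT (EFin \o (fun x => b ^+ 2 * phi x)).
  exact: (integrableZl measurableT (b ^+ 2) trim_class_integrable).
under eq_Rintegral do rewrite affE.
rewrite RintegralD//; last exact: (integrableD measurableT i4 i7).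
rewrite RintegralD// E6 E4.
rewrite [X in _ + (X + _)]big1; last first.
  by move=> i _; rewrite RintegralZl// integral_centered mulr0.
rewrite add0r RintegralZl//; last exact: trim_class_integrable.
rewrite mulrDr; congr (_ + _); last first.
  by rewrite mulrC -mulrA mulfV ?mulr1// gt_eqF.
rewrite mxE mulr_sumr.
under eq_bigr do rewrite E5 mulr_sumr.
under [RHS]eq_bigr do rewrite !mxE mulr_suml.
rewrite exchange_big/=; apply: eq_bigr => j _; apply: eq_bigr => i _.
rewrite RintegralZl; [|by []|exact: aff_mul_integrable].
rewrite trim_covE !mxE -/(u i) -/(u j); ring.
Qed.

(** For a direction [u], the constant term is chosen so that the form vanishes at the trimmed mean;
    its second moment is then the quadratic form of the covariance at [u]. *)
Lemma trim_cov_posdef :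
  (forall w, w != 0 -> 0 < \int[P]_x (aff w x ^+ 2 * phi x)) ->
  posdef (trim_cov P phi).
Proof.
move=> pos; split; first exact: trim_cov_sym.
move=> u u0; pose w : 'rV[R]_(k + 1) := row_mx u (- \sum_i u 0 i * T 0 i)%:M.
have w0 : w != 0 by rewrite row_mx_eq0 negb_and u0.
have awT : aff w T = 0 by rewrite aff_row_mx mxE eqxx mulr1n subrr.
have := trim_second_moment w; rewrite awT expr0n addr0 row_mxKl => <-.
by rewrite mulr_gt0 ?pos// invr_gt0 trim_mass_gt0.
Qed.

End trimmed_moments.

(** * Coercivity and tightness *)

Section coercivity.
Variables (R : realType) (k : nat).
Implicit Types (x : 'rV[R]_k) (w : 'rV[R]_(k + 1)) (Q : probability (borelRV R k) R).

Lemma continuous_max0 (X : topologicalType) (f : X -> R) :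
  continuous f -> continuous (fun z : X => Num.max (f z) 0).
Proof.
move=> cf x; apply: (@continuous_max _ _ f (fun=> 0)); first exact: cf.
exact: cvg_cst.
Qed.

(** Dividing by the norm of [(x, 1)] makes the form bounded without moving its zero set, so that
    weak convergence becomes applicable. *)
Definition naff w x := aff w x / lift_norm x.

Lemma naff_le w x : `|naff w x| <= k.+1%:R * `|w|.
Proof.
rewrite normrM normfV (gtr0_norm (lift_norm_gt0 x)).
by rewrite ler_pdivrMr ?lift_norm_gt0// aff_le.
Qed.

Lemma naffB w w' x : naff (w - w') x = naff w x - naff w' x.
Proof. by rewrite /naff affB mulrBl. Qed.

Lemma naff_sqr_le w x : naff w x ^+ 2 <= aff w x ^+ 2.
Proof.
rewrite /naff exprMn ler_piMr ?sqr_ge0// exprVn invf_le1 ?exprn_gt0 ?lift_norm_gt0//.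
by rewrite exprn_ege1// lift_norm_ge1.
Qed.

Lemma naff_sqr_continuous w : continuous (fun x => naff w x ^+ 2).
Proof.
have cn : continuous (naff w).
  apply: continuous_mul; first exact: aff_continuous.
  move=> x; apply: (@continuousV _ _ (@lift_norm R k)).
    by rewrite gt_eqF// lift_norm_gt0.
  exact: lift_norm_continuous.
exact: continuous_mul.
Qed.

Lemma naff_sqr_measurable w : measurable_fun [set: borelRV R k]
  ((fun x => naff w x ^+ 2) : borelRV R k -> R).
Proof. by apply: continuous_borelRV_measurable; exact: naff_sqr_continuous. Qed.

(** The dual integrand of [trimmed_integral_ge] for [q = naff w ^+ 2]: a bounded continuous bump
    around the zero set of [aff w]. *)
Definition slab w s x := Num.max (s - naff w x ^+ 2) 0.

Lemma slab_continuous w s : continuous (slab w s).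
Proof.
apply: continuous_max0; apply: continuous_add; first exact: cst_continuous.
move=> x; apply: (@continuousN _ _ _ (fun x => naff w x ^+ 2)).
exact: naff_sqr_continuous.
Qed.

Lemma slab_ge0 w s x : 0 <= slab w s x.
Proof. by rewrite le_max lexx orbT. Qed.

Lemma slab_le w s x : 0 <= s -> slab w s x <= s.
Proof. by move=> s0; rewrite ge_max s0 andbT gerBl sqr_ge0. Qed.

Lemma slab_norm_le w s x : 0 <= s -> `|slab w s x| <= s.
Proof. by move=> s0; rewrite ger0_norm ?slab_ge0// slab_le. Qed.

Lemma slab_measurable w s :
  measurable_fun [set: borelRV R k] (slab w s : borelRV R k -> R).
Proof. by apply: continuous_borelRV_measurable; exact: slab_continuous. Qed.

Lemma slab_integrable Q w s : 0 <= s -> Q.-integrable setT (EFin \o slab w s).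
Proof.
move=> s0; apply: (@bounded_integrable _ _ _ _ _ s).
  exact: slab_measurable.
by move=> x; exact: slab_norm_le.
Qed.

(** Equicontinuity in the direction, uniform in [x] and [s]. In the difference of squares one factor
    is at most [(k + 1) |w - w'|], the other at most [2 (k + 1)] on the unit sphere. *)
Lemma slab_lipschitz w w' s x : `|w| = 1 -> `|w'| = 1 ->
  slab w' s x <= slab w s x + 2 * k.+1%:R ^+ 2 * `|w - w'|.
Proof.
move=> w1 w'1; set e := _ * `|_|.
have e0 : 0 <= e by rewrite !mulr_ge0 ?sqr_ge0.
have de : naff w x ^+ 2 - naff w' x ^+ 2 <= e.
  rewrite subr_sqr -naffB (le_trans (ler_norm _))// normrM.
  have -> : e = (k.+1%:R * `|w - w'|) * (k.+1%:R * 2) by rewrite /e; ring.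
  rewrite ler_pM ?naff_le// (le_trans (ler_normD _ _))// mulr_natr mulr2n.
  by rewrite lerD//; [have := naff_le w x|have := naff_le w' x];
    rewrite ?w1 ?w'1 mulr1.
rewrite ge_max; apply/andP; split; last by rewrite addr_ge0// slab_ge0.
rewrite (@le_trans _ _ (s - naff w x ^+ 2 + e))//; last first.
  by rewrite lerD2r le_max lexx.
by rewrite -addrA lerD2l lerNl opprD opprK lerBlDr -lerBlDl.
Qed.

(** Replacing [aff] by [naff] only lowers the integral; duality then applies, with the mass of [psi]
    at least [gamma]. *)
Lemma aff_moment_ge Q (gamma s : R) psi w : 0 <= s -> trim_class Q gamma psi ->
  s * gamma - \int[Q]_x slab w s x <= \int[Q]_x (aff w x ^+ 2 * psi x).
Proof.
move=> s0 tpsi; have [mpsi psi01 _ _] := tpsi.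
have mn := naff_sqr_measurable w.
have bn x : naff w x ^+ 2 <= (k.+1%:R * `|w|) ^+ 2.
  by rewrite -real_normK ?num_real// lerXn2r ?nnegrE ?mulr_ge0// naff_le.
have inp : Q.-integrable setT (EFin \o (fun x : borelRV R k => naff w x ^+ 2 * psi
  x)).
  apply: (@bounded_integrable _ _ _ _ _ ((k.+1%:R * `|w|) ^+ 2)).
    exact: measurable_funM.
  move=> x; have /andP[p0 p1] := psi01 x.
  rewrite ger0_norm; last by rewrite mulr_ge0// sqr_ge0.
  by apply: le_trans (bn x); rewrite ler_piMr ?sqr_ge0.
have := trimmed_integral_ge mn (fun x => sqr_ge0 _) s0 mpsi psi01 inp.
rewrite -/(trim_mass Q psi) => h.
apply: (@le_trans _ _ (\int[Q]_x (naff w x ^+ 2 * psi x))).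
  by apply: le_trans h; rewrite lerD2r ler_wpM2l// (trim_mass_ge tpsi).
apply: le_Rintegral => //.
  by have := aff_mul_integrable tpsi w w.
by move=> x _; rewrite ler_wpM2r ?naff_sqr_le//; case/andP: (psi01 x).
Qed.

(** The sets where [naff w ^+ 2 <= 1 / (n + 1)] decrease to the zero set of [aff w], which is a
    hyperplane, or empty when the linear part is zero. One of them therefore has mass below [gamma];
    with [s = 1 / (n + 1)] the slab function is at most [s] on it and zero outside. *)
Lemma slab_hyperplane Q (gamma : R) w : 0 < gamma ->
  (forall H : set 'rV[R]_k, hyperplane H -> (Q H < gamma%:E)%E) ->
  w != 0 -> exists2 s, 0 < s & 0 < s * gamma - \int[Q]_x slab w s x.
Proof.
move=> g0 Hg w0.
have mn := naff_sqr_measurable w.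
pose F n : set (borelRV R k) := [set x | naff w x ^+ 2 <= n.+1%:R^-1].
have mF n : measurable (F n) := (measurable_sublevel n.+1%:R^-1 mn).1.
have QF : (Q (\bigcap_n F n) < gamma%:E)%E.
  have -> : \bigcap_n F n = [set x | aff w x = 0].
    apply/seteqP; split=> x /=; last first.
      by move=> wx n _; rewrite /F/= /naff wx mul0r expr2 mul0r invr_ge0.
    move=> Fx; apply/eqP; have : naff w x ^+ 2 <= 0.
      apply/ler_addgt0Pr => e e0; have := Fx (Num.trunc e^-1) I.
      rewrite add0r => /le_trans; apply; rewrite invf_ple ?posrE ?ltr0Sn//.
      by rewrite ltW// truncnS_gt.
    rewrite le_eqVlt ltNge sqr_ge0 orbF sqrf_eq0 mulf_eq0 invr_eq0.
    by rewrite (gt_eqF (lift_norm_gt0 x)) orbF.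
  have [u0|u0] := eqVneq (lsubmx w) 0; last first.
    apply: Hg; exists (lsubmx w), (- w 0 (rshift k 0)); split=> //.
    apply/seteqP; split=> x /=; rewrite /aff.
      move=> /eqP; rewrite addr_eq0 => /eqP <-.
      by apply: eq_bigr => i _; rewrite mxE.
    under eq_bigr do rewrite mxE.
    by move=> ->; rewrite addNr.
  have b0 : w 0 (rshift k 0) != 0.
    apply: contraNneq w0 => b0; rewrite -(hsubmxK w) row_mx_eq0 u0 eqxx/=.
    by apply/eqP/matrixP => i j; rewrite !ord1 !mxE.
  rewrite (_ : [set x | aff w x = 0] = set0) ?measure0 ?lte_fin//.
  apply/seteqP; split=> x //=; rewrite /aff big1 ?add0r => [|i _].
    by move/eqP; rewrite (negbTE b0).
  by have /matrixP/(_ 0 i) := u0; rewrite !mxE => ->; rewrite mul0r.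
have [n Qn] : exists n, (Q (F n) < gamma%:E)%E.
  apply: contrapT => /forallNP nF; move: QF; apply/negP; rewrite -leNgt.
  apply: bigcap_probability_ge => //.
    move=> n m nm; apply/subsetPset => x /= /le_trans; apply.
    by rewrite lef_pV2 ?posrE// ler_nat.
  by move=> n; rewrite leNgt; apply/negP/nF.
have s0 : 0 < n.+1%:R^-1 :> R by rewrite invr_gt0.
exists n.+1%:R^-1 => //; set s := n.+1%:R^-1 in s0 *.
rewrite subr_gt0; apply: (@le_lt_trans _ _ (s * fine (Q (F n)))); last first.
  by rewrite ltr_pM2l// -lte_fin fineK// fin_num_measure.
have iF := integrable_indic Q (mF n).
have -> : s * fine (Q (F n)) = \int[Q]_x (s * \1_(F n) x).
  by rewrite RintegralZl// /Rintegral integral_indic// setIT.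
apply: le_Rintegral => //.
  by apply: slab_integrable; exact: ltW.
  exact: (integrableZl measurableT s iF).
move=> x _; rewrite indicE; have [xF|nxF] := boolP (x \in F n).
  by rewrite mulr1 slab_le// ltW.
rewrite mulr0 /slab ge_max lexx andbT subr_le0 ltW// ltNge.
by move: nxF; rewrite notin_setE => /negP.
Qed.

Lemma sphere_compact n : compact [set w : 'rV[R]_n | `|w| = 1].
Proof.
apply: bounded_closed_compact.
  by exists 1; split; [exact: num_real|move=> M M1 w /= ->; exact: ltW].
change (closed ((fun w : 'rV[R]_n => `|w|) @^-1` [set 1 : R])).
apply: preimage_closed; last exact: closed_eq.
by move=> w _; exact: norm_continuous.
Qed.

(** At a unit direction, weak convergence transfers the strict bound of [slab_hyperplane] to large
    [t], and [slab_lipschitz] spreads it to nearby directions. Compactness of the sphere makes it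
    uniform, and homogeneity extends it to all [w]. *)
Lemma uniform_coercivity (P : nat -> probability (borelRV R k) R) Q (gamma : R) :
  0 < gamma ->
  (forall H : set 'rV[R]_k, hyperplane H -> (Q H < gamma%:E)%E) ->
  weak_cvg P Q ->
  exists2 c : R, 0 < c & \forall t \near \oo, forall w psi,
    trim_class (P t) gamma psi ->
    c * `|w| ^+ 2 <= \int[P t]_x (aff w x ^+ 2 * psi x).
Proof.
move=> g0 Hg PQ.
(* The index pairs the time with the candidate constant, so that one covering argument produces both
   the threshold in [t] and the constant. *)
pose G (i : nat * R) w := forall psi, trim_class (P i.1) gamma psi ->
  i.2 <= \int[P i.1]_x (aff w x ^+ 2 * psi x).
have := (sphere_compact (n := k + 1)).
move=> /compact_near_coveringP/near_covering_withinP.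
move=> /(_ _ (filter_prod \oo (0 : R)^'+) G _)[].
  move=> w /= w1; have w0 : w != 0 by rewrite -normr_eq0 w1 oner_eq0.
  have [s s0 hs] := slab_hyperplane g0 Hg w0.
  (* A third of the gap [D] is spent on weak convergence, a third on the change of direction, and
     the last third bounds the constant. *)
  set D := _ - _ in hs; pose e := D / 3.
  have e0 : 0 < e by rewrite divr_gt0.
  pose L : R := 2 * k.+1%:R ^+ 2.
  have L0 : 0 < L by rewrite mulr_gt0// exprn_gt0.
  have sM : exists M : R, forall x, `|slab w s x| <= M.
    by exists s => x; apply: slab_norm_le; exact: ltW.
  have cv := PQ _ (@slab_continuous w s) sM.
  have eL : 0 < e / L by rewrite divr_gt0.
  exists (ball w (e / L), [set i | (\int[P i.1]_x slab w s x < \int[Q]_x slab w s x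
    + e) /\ i.2 < e]).
    split=> /=; first exact: nbhsx_ballx.
    exists ([set t | \int[P t]_x slab w s x < \int[Q]_x slab w s x + e],
            [set c | c < e]).
      split=> /=; last exact: nbhs_right_lt.
      by apply: (cvgr_lt _ cv); rewrite ltrDl.
    by move=> [t c].
  move=> [w' [t c]] [/= + [Pt ce]] w'1 psi /= tpsi.
  rewrite -ball_normE /= => ww'.
  apply: le_trans (aff_moment_ge w' (ltW s0) tpsi).
  apply: (@le_trans _ _ (s * gamma - (\int[P t]_x slab w s x + e))); last first.
    rewrite lerD2l lerN2.
    have <- : \int[P t]_x (slab w s x + e) = \int[P t]_x slab w s x + e.
      rewrite RintegralD//; last 2 first.
      - by apply: slab_integrable; exact: ltW.
      - by apply: (@bounded_integrable _ _ _ _ _ `|e|).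
      by rewrite Rintegral_cst// (congr1 fine (probability_setT (P t))) mulr1.
    apply: le_Rintegral => //.
    - by apply: slab_integrable; exact: ltW.
    - have i1 := slab_integrable (P t) w (ltW s0).
      have i2 : (P t).-integrable setT (EFin \o (fun=> e)).
        by apply: (@bounded_integrable _ _ _ _ _ `|e|).
      exact: (integrableD measurableT i1 i2).
    move=> x _; apply: (le_trans (slab_lipschitz s x w1 w'1)).
    rewrite lerD2l -/L mulrC -ler_pdivlMr// ltW//.
  have De : D = 3 * e by rewrite /e mulrC divfK.
  rewrite /D in De; lra.
move=> [A B] [/= Ao B0] AB.
have [c [Bc c0]] : exists c, B c /\ 0 < c.
  have : \forall c \near 0^'+, B c /\ 0 < c.
    by near=> c; split; near: c => //; exact: nbhs_right_gt.
  by move/filter_ex.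
exists c => //; near=> t => w psi tpsi.
have [->|w0] := eqVneq w 0.
  by rewrite normr0 expr0n mulr0; apply: Rintegral_ge0 => x _;
    rewrite mulr_ge0 ?sqr_ge0//; have [_ /(_ x)/andP[]] := tpsi.
have nw : `|w| != 0 by rewrite normr_eq0.
pose v := `|w|^-1 *: w.
have v1 : `|v| = 1 by rewrite normrZ normfV normr_id mulVf.
have At : A t by near: t.
have := AB (t, c) (conj At Bc) v v1 psi tpsi => /= cv.
have -> : \int[P t]_x (aff w x ^+ 2 * psi x) = `|w| ^+ 2 * \int[P t]_x (aff v x ^+
  2 * psi x).
  rewrite -RintegralZl//; last by have := aff_mul_integrable tpsi v v.
  apply: eq_Rintegral => x _; rewrite affZ; field.
  by rewrite nw.
by rewrite mulrC ler_pM2l// exprn_gt0// lt_def nw normr_ge0.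
Unshelve. all: by end_near. Qed.

(** As [gamma < 1], some ball of radius [n] has limit mass above [gamma]. A continuous cutoff, equal
    to 1 on that ball and 0 beyond radius [n + 1], carries this along the weak limit. *)
Lemma tightness (P : nat -> probability (borelRV R k) R) Q (gamma : R) :
  gamma < 1 -> weak_cvg P Q ->
  exists2 r : R, 0 < r & \forall t \near \oo, (gamma%:E < P t (enorm_ball r))%E.
Proof.
move=> g1 PQ.
have mB := @enorm_ball_measurable R k.
have [n Qn] : exists n : nat, (gamma%:E < Q (enorm_ball n%:R))%E.
  apply: contrapT => /forallNP nF.
  have : (Q (\bigcup_n enorm_ball n%:R) <= gamma%:E)%E.
    apply: bigcup_probability_le => //.
      move=> n m nm; apply/subsetPset => x /= /le_trans; apply.
      by rewrite ler_nat.
    by move=> n; rewrite leNgt; apply/negP/nF.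
  rewrite (_ : \bigcup_n _ = setT) ?probability_setT ?lee_fin ?leNgt ?g1//.
  apply/seteqP; split=> x //= _; exists (Num.trunc (enorm x)).+1 => //=.
  by rewrite /enorm_ball/= ltW// truncnS_gt.
pose f x := Num.max (1 - Num.max (enorm x - n%:R) 0) 0.
have cf : continuous f.
  apply: continuous_max0; apply: continuous_add; first exact: cst_continuous.
  move=> x; apply: (@continuousN _ _ _ (fun x => Num.max (enorm x - n%:R) 0)).
  apply: continuous_max0; apply: continuous_add; last exact: cst_continuous.
  exact: enorm_continuous.
have f01 x : 0 <= f x <= 1.
  by rewrite le_max lexx orbT ge_max ler01 andbT gerBl le_max lexx orbT.
have f1 x : `|f x| <= 1 by have /andP[f0 ?] := f01 x; rewrite ger0_norm.
have mf : measurable_fun [set: borelRV R k] (f : borelRV R k -> R).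
  exact: continuous_borelRV_measurable.
have ifP Q' : Q'.-integrable setT (EFin \o (f : borelRV R k -> R)).
  exact: (@bounded_integrable _ _ _ _ _ 1).
have cv := PQ f cf (ex_intro _ 1 f1).
exists n.+1%:R => //; near=> t.
have gt : gamma < \int[P t]_x f x.
  near: t; apply: (cvgr_gt _ cv).
  have iB := integrable_indic Q (mB n%:R).
  apply: (@lt_le_trans _ _ (\int[Q]_x \1_(enorm_ball n%:R) x)).
    by rewrite /Rintegral integral_indic// setIT -lte_fin fineK// fin_num_measure.
  apply: le_Rintegral => //; first exact: ifP.
  move=> x _; rewrite indicE; have [xB|_] := boolP (x \in _);
    last by case/andP: (f01 x).
  rewrite /f; have /max_idPr -> : enorm x - n%:R <= 0 by rewrite subr_le0;
    exact: (set_mem xB).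
  by rewrite subr0 le_max lexx.
have iB := integrable_indic (P t) (mB n.+1%:R).
have PE : (P t (enorm_ball n.+1%:R) = (\int[P t]_x \1_(enorm_ball n.+1%:R) x)%:E)%E.
  by rewrite /Rintegral integral_indic// setIT fineK// fin_num_measure.
rewrite PE lte_fin; apply: (lt_le_trans gt); apply: le_Rintegral => //;
  first exact: ifP.
move=> x _; rewrite indicE; have [xB|nxB] := boolP (x \in _).
  by case/andP: (f01 x).
move: nxB; rewrite notin_setE /enorm_ball/= => /negP; rewrite -ltNge => nx.
rewrite ge_max lexx andbT subr_le0 le_max; apply/orP; left.
by rewrite lerBrDr -natr1 addrC in nx *; exact: ltW.
Unshelve. all: by end_near. Qed.

End coercivity.

(** * Quadratic functionals *)

Section matrix_bounds.
Variable R : realType.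

Lemma mx_norm_le m n (A : 'M[R]_(m, n)) a :
  0 <= a -> (forall i j, `|A i j| <= a) -> `|A| <= a.
Proof.
move=> a0 Aa; rewrite [leLHS]/Num.norm /= mx_normrE.
by apply: bigmax_le => // -[i j] _; exact: Aa.
Qed.

Lemma det_norm_le n (A : 'M[R]_n) a : (forall i j, `|A i j| <= a) ->
  `|\det A| <= n`!%:R * a ^+ n.
Proof.
move=> Aa; rewrite /determinant (le_trans (ler_norm_sum _ _ _))//.
rewrite -card_Sn mulr_natl -sumr_const; apply: ler_sum => s _.
rewrite normrM normrX normrN1 expr1n mul1r normr_prod.
rewrite -[X in a ^+ X](card_ord n) -prodr_const.
by apply: ler_prod => i _; rewrite normr_ge0 Aa.
Qed.

(** The inverse of a matrix of determinant one is its adjugate, whose entries are bounded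
    polynomially by those of the matrix. *)
Lemma det1_solution_le n (A : 'M[R]_n) (x : 'rV[R]_n) a b : \det A = 1 ->
  (forall i j, `|A i j| <= a) -> (forall j, `|(x *m A^T) 0 j| <= b) ->
  forall i, `|x 0 i| <= n%:R * (b * ((n.-1)`!%:R * a ^+ n.-1)).
Proof.
move=> dA Aa xb i.
have xE : x = x *m A^T *m \adj (A^T).
  by rewrite -mulmxA mul_mx_adj det_tr dA mulmx1.
rewrite {1}xE mxE (le_trans (ler_norm_sum _ _ _))//.
rewrite mulr_natl -[X in _ *+ X](card_ord n) -sumr_const.
apply: ler_sum => j _; rewrite normrM ler_pM//.
rewrite mxE /cofactor normrM normrX normrN1 expr1n mul1r.
by apply: det_norm_le => p q; rewrite !mxE.
Qed.

Lemma continuous_prod_seq (X : topologicalType) (I : Type) (s : seq I)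
    (F : I -> X -> R) :
  (forall i, continuous (F i)) -> continuous (fun x => \prod_(i <- s) F i x).
Proof.
move=> cF; elim: s => [|i s IHs].
  under eq_fun do rewrite big_nil.
  exact: cst_continuous.
under eq_fun do rewrite big_cons.
exact: continuous_mul.
Qed.

Lemma continuous_det (X : topologicalType) n (A : X -> 'M[R]_n) :
  (forall i j, continuous (fun x => A x i j)) -> continuous (fun x => \det (A x)).
Proof.
move=> cA; apply: continuous_sum_seq => s; apply: continuous_mul.
  exact: cst_continuous.
by apply: continuous_prod_seq => i; exact: cA.
Qed.

End matrix_bounds.

(** * The function [|A x + b|^2] and its trimmed averages *)

Section quadratic.
Variables (R : realType) (k : nat).
Implicit Types (x : 'rV[R]_k) (W : 'M[R]_(k, k + 1)) (Q : probability (borelRV R k)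
  R).

Definition quad W x : R := \sum_j aff (row j W) x ^+ 2.

Lemma quad_ge0 W x : 0 <= quad W x.
Proof. by apply: sumr_ge0 => j _; exact: sqr_ge0. Qed.

Lemma quad_continuous W : continuous (quad W).
Proof.
apply: continuous_sum_seq => j; apply: continuous_mul; exact: aff_continuous.
Qed.

Lemma quad_measurable W :
  measurable_fun [set: borelRV R k] (quad W : borelRV R k -> R).
Proof. by apply: continuous_borelRV_measurable; exact: quad_continuous. Qed.

Lemma row_norm_le W j M : 0 <= M -> (forall i j, `|W i j| <= M) -> `|row j W| <= M.
Proof. by move=> M0 WM; apply: mx_norm_le => // i l; rewrite mxE. Qed.

Lemma lift_norm_ball x r : enorm x <= r -> lift_norm x ^+ 2 <= 1 + r ^+ 2.
Proof.
move=> xr; rewrite lift_norm_sqr lerD2l lerXn2r ?nnegrE ?sqrtr_ge0//.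
exact: le_trans (sqrtr_ge0 _) xr.
Qed.

(** Each difference of squares factors into the forms [w - w'] and [w + w'], of norms at most [e]
    and [2 M]. *)
Lemma quad_lipschitz W W' M e r x : 0 <= M -> 0 <= e ->
  (forall i j, `|W i j| <= M) -> (forall i j, `|W' i j| <= M) ->
  (forall i j, `|W i j - W' i j| <= e) -> enorm x <= r ->
  quad W x <= quad W' x + k%:R * (k.+1%:R ^+ 2 * (2 * M) * (1 + r ^+ 2)) * e.
Proof.
move=> M0 e0 WM WM' We xr; rewrite -lerBlDl -sumrB.
rewrite -mulrA mulr_natl -[X in _ *+ X](card_ord k) -sumr_const.
apply: ler_sum => j _; rewrite (le_trans (ler_norm _))//.
have -> : aff (row j W) x ^+ 2 - aff (row j W') x ^+ 2 =
   aff (row j W - row j W') x * aff (row j W - (- 1) *: row j W') x.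
  by rewrite !affB affZ; ring.
apply: (le_trans (aff_mul_le _ _ _)).
have l0 := lift_norm_ball xr.
have d1 : `|row j W - row j W'| <= e by apply: mx_norm_le => // p q; rewrite !mxE.
have d2 : `|row j W - -1 *: row j W'| <= 2 * M.
  rewrite scaleN1r opprK (le_trans (ler_normD _ _))// mulr_natl mulr2n.
  by rewrite lerD ?row_norm_le.
rewrite [leRHS](_ : _ = k.+1%:R ^+ 2 * e * (2 * M) * (1 + r ^+ 2)); last by ring.
by rewrite ler_pM ?sqr_ge0 ?mulr_ge0 ?sqr_ge0// ler_pM ?mulr_ge0 ?sqr_ge0//
  ler_wpM2l// sqr_ge0.
Qed.

Lemma quad_le W M r x : 0 <= M -> (forall i j, `|W i j| <= M) -> enorm x <= r ->
  quad W x <= k%:R * (k.+1%:R ^+ 2 * M * M * (1 + r ^+ 2)).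
Proof.
move=> M0 WM xr; rewrite mulr_natl -[X in _ *+ X](card_ord k) -sumr_const.
apply: ler_sum => j _; rewrite (le_trans (ler_norm _))// expr2.
apply: (le_trans (aff_mul_le _ _ _)).
have l0 := lift_norm_ball xr.
by rewrite ler_pM ?sqr_ge0 ?mulr_ge0 ?sqr_ge0// ler_pM ?mulr_ge0 ?sqr_ge0//
  ?row_norm_le// ler_wpM2l ?sqr_ge0 ?row_norm_le.
Qed.

(** Confines the ellipsoids to a common ball: each entry of [A x + b] has square at most [s], and
    [det1_solution_le] recovers [x] from [A x]. The summands 1 come from bounding a square root by
    one plus its argument. *)
Lemma quad_bounded_le W M s x : \det (lsubmx W) = 1 -> 0 <= M -> 0 <= s ->
  (forall i j, `|W i j| <= M) -> quad W x <= s ->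
  enorm x <= 1 + k%:R * (k%:R * ((1 + s + M) * ((k.-1)`!%:R * M ^+ k.-1))) ^+ 2.
Proof.
move=> dW M0 s0 WM xs.
have affj j : `|aff (row j W) x| <= 1 + s.
  have aj : `|aff (row j W) x| ^+ 2 <= s.
    rewrite real_normK ?num_real//; apply: le_trans xs.
    rewrite /quad (bigD1 j)//= lerDl; apply: sumr_ge0 => i _; exact: sqr_ge0.
  have := normr_ge0 (aff (row j W) x); nra.
have h := @det1_solution_le R k (lsubmx W) x M (1 + s + M) dW _ _.
have {h}xi : forall i, `|x 0 i| <= k%:R * ((1 + s + M) * ((k.-1)`!%:R * M ^+ k.-1)).
  apply: h => [i j|j]; first by rewrite mxE.
  have -> : (x *m (lsubmx W)^T) 0 j = aff (row j W) x - W j (rshift k 0).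
    rewrite /aff !mxE addrK; apply: eq_bigr => i _; by rewrite !mxE mulrC.
  by rewrite (le_trans (ler_normB _ _))// lerD.
set B := _ * _ in xi *.
have : enorm x ^+ 2 <= k%:R * B ^+ 2.
  rewrite /enorm sqr_sqrtr; last by apply: sumr_ge0 => i _; exact: sqr_ge0.
  rewrite mulr_natl -[X in _ *+ X](card_ord k) -sumr_const; apply: ler_sum => i _.
  by rewrite -real_normK ?num_real// lerXn2r ?nnegrE// (le_trans (normr_ge0 _) (xi
    i)).
have : 0 <= enorm x := sqrtr_ge0 _.
move: (enorm x) (k%:R * B ^+ 2) => a b; nra.
Qed.

Section fixed_trimming.
Variables (Q : probability (borelRV R k) R) (gamma : R).
Variable phi : borelRV R k -> R.
Hypotheses (gamma_gt0 : 0 < gamma) (tphi : trim_class Q gamma phi).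

Definition trim_avg W := (trim_mass Q phi)^-1 * \int[Q]_x (quad W x * phi x).

Lemma quad_integrable W :
  Q.-integrable setT (EFin \o (fun x => quad W x * phi x)) /\
  \int[Q]_x (quad W x * phi x) =
    \sum_j \int[Q]_x (aff (row j W) x ^+ 2 * phi x).
Proof.
have [i1 E1] := Rintegral_sum_seq (index_enum 'I_k)
  (fun j => aff_mul_integrable tphi (row j W) (row j W)).
split.
  by apply: eq_integrable i1 => // x _ /=; rewrite /quad mulr_suml.
by rewrite -E1; apply: eq_Rintegral => x _; rewrite /quad mulr_suml.
Qed.

Lemma trim_avgE W : trim_avg W =
  \tr (lsubmx W *m trim_cov Q phi *m (lsubmx W)^T) +
  \sum_j aff (row j W) (trim_mean Q phi) ^+ 2.
Proof.
rewrite /trim_avg (quad_integrable W).2 mulr_sumr /mxtrace -big_split/=.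
apply: eq_bigr => j _; rewrite (trim_second_moment gamma_gt0 tphi); congr (_ + _).
have -> : lsubmx (row j W) = row j (lsubmx W).
  by apply/matrixP => p q; rewrite !mxE.
rewrite -row_mul mxE [RHS]mxE; apply: eq_bigr => l _.
by congr (_ * _); [rewrite mxE|rewrite !mxE].
Qed.

(** Dropping the squared offset at the trimmed mean leaves the trace handled by
    [det_le_trace_congr]. *)
Lemma det_trim_cov_le W : posdef (trim_cov Q phi) -> \det (lsubmx W) = 1 ->
  \det (trim_cov Q phi) <= (trim_avg W / k%:R) ^+ k.
Proof.
move=> pC dW; have := det_le_trace_congr pC dW => /le_trans; apply.
have pB : posdef (lsubmx W *m trim_cov Q phi *m (lsubmx W)^T).
  by apply: posdef_congr => //; rewrite unitmxE dW unitr1.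
have tr0 : 0 <= \tr (lsubmx W *m trim_cov Q phi *m (lsubmx W)^T).
  by apply: sumr_ge0 => i _; apply: ltW; exact: posdef_diag_gt0.
have le1 : \tr (lsubmx W *m trim_cov Q phi *m (lsubmx W)^T) <= trim_avg W.
  by rewrite trim_avgE lerDl; apply: sumr_ge0 => j _; exact: sqr_ge0.
by rewrite lerXn2r ?nnegrE ?divr_ge0 ?(le_trans tr0 le1)// ler_wpM2r// invr_ge0.
Qed.

(** Equality is reached by an [A] making the covariance isotropic and [b = - A T], which cancels the
    offset. *)
Lemma det_trim_covE : posdef (trim_cov Q phi) ->
  exists W, \det (lsubmx W) = 1 /\
    (trim_avg W / k%:R) ^+ k = \det (trim_cov Q phi).
Proof.
move=> pC; have [A [c [dA AE]]] := posdef_isotropic pC.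
pose T := trim_mean Q phi.
pose W : 'M[R]_(k, k + 1) := row_mx A (- (A *m T^T)).
exists W; rewrite trim_avgE row_mxKl; split=> //.
rewrite AE big1 ?addr0 => [|j _]; last first.
  rewrite row_row_mx aff_row_mx !mxE.
  under eq_bigr do rewrite mxE.
  under [X in _ - X]eq_bigr do rewrite mxE.
  by rewrite subrr expr2 mul0r.
have := congr1 determinant AE; rewrite !det_mulmx det_tr dA mul1r mulr1 => ->.
(* For [k = 0] the division is degenerate, but both sides are empty powers. *)
rewrite det_scalar mxtrace_scalar; have [k0|k0] := eqVneq (k%:R : R) 0.
  have expk (a : R) : a ^+ k = 1.
    by move/eqP: k0; rewrite pnatr_eq0 => /eqP ->.
  by rewrite !expk.
by rewrite -(mulr_natr c) mulfK.
Qed.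

(** The row containing the entry already contributes this much, and normalizing by a mass at most
    one only increases the average. *)
Lemma trim_avg_ge W c : 0 < c ->
  (forall w, c * `|w| ^+ 2 <= \int[Q]_x (aff w x ^+ 2 * phi x)) ->
  forall i j, c * `|W i j| ^+ 2 <= trim_avg W.
Proof.
move=> c0 coer i j; have m0 := trim_mass_gt0 gamma_gt0 tphi.
have m1 := trim_mass_le1 tphi.
have I0 l : 0 <= \int[Q]_x (aff (row l W) x ^+ 2 * phi x).
  by apply: le_trans (coer _); rewrite mulr_ge0 ?sqr_ge0 ?ltW.
apply: (@le_trans _ _ (\int[Q]_x (quad W x * phi x))); last first.
  rewrite /trim_avg ler_peMl ?invf_ge1//.
  by rewrite (quad_integrable W).2; exact: sumr_ge0.
rewrite (quad_integrable W).2 (bigD1 i)//=.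
apply: (@le_trans _ _ (c * `|row i W| ^+ 2)).
  rewrite ler_pM2l// lerXn2r ?nnegrE//.
  by have := mx_entry_le_norm (row i W) 0 j; rewrite mxE.
by rewrite (le_trans (coer _))// lerDl; exact: sumr_ge0.
Qed.

End fixed_trimming.

End quadratic.

(** * Existence of a minimizer *)

Section existence.
Variables (R : realType) (k : nat).
Implicit Types (Q : probability (borelRV R k) R) (W : 'M[R]_(k, k + 1)).

Lemma trim_class_bounded_support Q (gamma r : R) (phi : borelRV R k -> R) :
  measurable_fun setT phi -> (forall x, 0 <= phi x <= 1) ->
  gamma <= \int[Q]_x phi x -> [set x | phi x != 0] `<=` enorm_ball r ->
  trim_class_ball Q gamma r phi.
Proof.
move=> mphi phi01 gphi sphi; split=> //; split=> //.
  move: gphi; rewrite -lee_fin /Rintegral fineK//.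
  exact: integrable_fin_num (unit_integrable Q mphi phi01).
have b2 (x : borelRV R k) : `|enorm x ^+ 2 * phi x| <= r ^+ 2.
  have /andP[p0 p1] := phi01 x.
  rewrite ger0_norm; last by rewrite mulr_ge0// sqr_ge0.
  have [->|px] := eqVneq (phi x) 0; first by rewrite mulr0 sqr_ge0.
  have xr : enorm x <= r by exact: sphi.
  have e0 : 0 <= enorm x := sqrtr_ge0 _.
  apply: (@le_trans _ _ (enorm x ^+ 2)); first by rewrite ler_piMr// sqr_ge0.
  by rewrite lerXn2r// nnegrE// (le_trans e0).
have i2 : Q.-integrable setT (EFin \o (fun x => enorm x ^+ 2 * phi x)).
  apply: (@bounded_integrable _ _ _ _ _ (r ^+ 2)) => //.
  by apply: measurable_funM => //; apply: measurable_funX; exact: enorm_measurable.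
by have := integrable_fin_num measurableT i2; rewrite fin_numElt => /andP[].
Qed.

(** Matrices are flattened to row vectors so that compactness and the extreme value theorem for row
    vectors apply. *)
Definition feasible (M : R) : set 'rV[R]_(k * (k + 1)) :=
  [set v | `|v| <= M /\ \det (lsubmx (vec_mx v : 'M[R]_(k, k + 1))) = 1].

Lemma feasible_entry M v i j : feasible M v
  -> `|(vec_mx v : 'M[R]_(k, k + 1)) i j| <= M.
Proof.
by move=> [vM _]; rewrite mxE (le_trans (mx_entry_le_norm _ _ _)).
Qed.

Lemma feasible_mxvec M W : 0 <= M -> (forall i j, `|W i j| <= M) ->
  \det (lsubmx W) = 1 -> feasible M (mxvec W).
Proof.
move=> M0 WM dW; split; last by rewrite mxvecK.
apply: mx_norm_le => // i j; rewrite !ord1.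
by case/mxvec_indexP: j => p q; rewrite mxvecE.
Qed.

Lemma feasible_compact M : compact (feasible M).
Proof.
apply: bounded_closed_compact.
  exists M; split; first exact: num_real.
  by move=> N MN v [vM _]; exact: le_trans (ltW MN).
apply: closedI.
  change (closed ((fun v : 'rV[R]_(k * (k + 1)) => `|v|) @^-1` [set x : R | x <= M])).
  apply: preimage_closed; last exact: closed_le.
  by move=> v _; exact: norm_continuous.
change (closed ((fun v => \det (lsubmx (vec_mx v : 'M[R]_(k, k + 1)))) @^-1` [set 1
  : R])).
apply: preimage_closed; last exact: closed_eq.
move=> v _; apply: continuous_det => i j.
under eq_fun do rewrite !mxE.
exact: coord_continuous.
Qed.

(** The radius [rho] is built before [Q] is introduced, from [k], [c] and [r] only; hence it is
    common to all measures with the same coercivity and tightness constants. *)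
Lemma exists_minimizer (gamma c r : R) : 0 < gamma < 1 -> 0 < c -> 0 < r ->
  exists2 rho : R, 0 < rho & forall Q,
    (forall w psi, trim_class Q gamma psi ->
      c * `|w| ^+ 2 <= \int[Q]_x (aff w x ^+ 2 * psi x)) ->
    (gamma%:E < Q (enorm_ball r))%E ->
    exists phi, trim_class_ball Q gamma rho phi /\ minimizes_det_cov Q gamma phi.
Proof.
move=> g01 c0 r0; have /andP[g0 g1] := g01.
(* A competitive [W] has [c |W i j|^2 <= r^2], and [1 + a] dominates the square root of [a]; the
   summand 1 also admits the identity matrix. *)
pose M := 1 + r ^+ 2 / c; have rc0 : 0 <= r ^+ 2 / c by rewrite divr_ge0 ?sqr_ge0
  ?ltW.
have M1 : 1 <= M by rewrite lerDl.
have M0 : 0 <= M := le_trans ler01 M1.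
(* [S] bounds [quad] on the ball of radius [r]; [rho] below is the radius given by [quad_bounded_le]
   at level [S]. *)
pose S := k%:R * (k.+1%:R ^+ 2 * M * M * (1 + r ^+ 2)).
have S0 : 0 <= S by rewrite !mulr_ge0 ?addr_ge0 ?sqr_ge0.
pose rho := 1 + k%:R * (k%:R * ((1 + S + M) * ((k.-1)`!%:R * M ^+ k.-1))) ^+ 2.
have rho0 : 0 < rho by rewrite ltr_pwDl// mulr_ge0// sqr_ge0.
exists rho => // Q coer QB.
have coer' psi : trim_class Q gamma psi -> forall w,
    c * `|w| ^+ 2 <= \int[Q]_x (aff w x ^+ 2 * psi x) by move=> tpsi w; exact: coer.
have posC psi : trim_class Q gamma psi -> posdef (trim_cov Q psi).
  move=> tpsi; apply: (trim_cov_posdef g0 tpsi) => w w0.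
  apply: lt_le_trans (coer _ _ tpsi); rewrite mulr_gt0// exprn_gt0//.
  by rewrite normr_gt0.
(* Feasibility is assumed under the existential so that [choice] returns a total function of [v]. *)
have opt v : exists phi, feasible M v ->
    [/\ trim_class_ball Q gamma rho phi, trim_mass Q phi = gamma &
     forall psi, trim_class Q gamma psi ->
       trim_avg Q phi (vec_mx v) <= trim_avg Q psi (vec_mx v)].
  have [s [phi [[mphi phi01 iphi] [Qs sphi ophi]]]] :=
    optimal_trimming Q (quad_measurable (vec_mx v)) (quad_ge0 (vec_mx v)) g01.
  exists phi => fv; have vM i j := feasible_entry i j fv.
  (* The ball has mass above [gamma] and the set [quad < s] at most [gamma], so some point of the
     ball has [quad] at least [s]. *)
  have sS : s <= S.
    have [x /= xr sx] : exists2 x, enorm_ball r x & s <= quad (vec_mx v) x.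
      apply: contrapT => nx; move: QB; apply/negP; rewrite -leNgt.
      apply: le_trans Qs; apply: le_measure; rewrite ?inE.
      - exact: enorm_ball_measurable.
      - exact: (measurable_sublevel s (quad_measurable (vec_mx v))).2.
      - move=> x xr /=; rewrite ltNge; apply/negP => sx.
        by apply: nx; exists x.
    exact: le_trans sx (quad_le M0 vM xr).
  split=> //.
    apply: trim_class_bounded_support => //; first by rewrite iphi.
    move=> x /= /sphi qs; apply: quad_bounded_le fv.2 M0 S0 vM _.
    exact: le_trans sS.
  move=> psi tpsi; have [mpsi psi01 _ _] := tpsi.
  rewrite /trim_avg [X in X^-1](_ : _ = gamma)//.
  apply: ophi => //; first exact: trim_mass_ge tpsi.
  exact: (quad_integrable tpsi _).1.
have [Phi PhiP] := choice opt.
pose F v := trim_avg Q (Phi v) (vec_mx v).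
pose W0 : 'M[R]_(k, k + 1) := row_mx 1%:M 0.
have fW0 : feasible M (mxvec W0).
  apply: feasible_mxvec => //; last by rewrite row_mxKl det1.
  move=> i j; rewrite mxE; case: splitP => l _; rewrite !mxE.
    by case: eqVneq; rewrite ?normr1 ?normr0.
  by rewrite normr0.
(* For [W0], that is [A = 1] and [b = 0], [quad] is the squared Euclidean norm; the indicator of the
   ball is a competitor with average at most [r^2]. *)
have FW0 : F (mxvec W0) <= r ^+ 2.
  have mB : measurable (enorm_ball r : set (borelRV R k)).
    exact: enorm_ball_measurable.
  pose psi : borelRV R k -> R := \1_(enorm_ball r).
  have mpsi : measurable_fun setT psi by exact: measurable_indic.
  have psi01 x : 0 <= psi x <= 1.
    by rewrite /psi indicE; case: (_ \in _); rewrite ?lexx ?ler01.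
  have ipsi := unit_integrable Q mpsi psi01.
  have [tpsi _] : trim_class_ball Q gamma r psi.
    apply: trim_class_bounded_support => //.
      by rewrite /Rintegral integral_indic// setIT -lee_fin fineK ?ltW//
        fin_num_measure.
    by move=> x; apply: contra_neqP => nx; rewrite /psi indicE memNset.
  have [_ _ h] := PhiP _ fW0; apply: (le_trans (h psi tpsi)); rewrite mxvecK.
  have m0 := trim_mass_gt0 g0 tpsi.
  rewrite /trim_avg mulrC ler_pdivrMr// /trim_mass -RintegralZl//.
  apply: le_Rintegral => //; first exact: (quad_integrable tpsi _).1.
    exact: (integrableZl measurableT (r ^+ 2) ipsi).
  move=> x _; rewrite /psi indicE; have [/set_mem xr|_] := boolP (x \in _);
    last by rewrite !mulr0.
  rewrite !mulr1 (_ : quad W0 x = enorm x ^+ 2).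
    by rewrite lerXn2r ?nnegrE ?sqrtr_ge0// ltW.
  rewrite /enorm sqr_sqrtr; last by apply: sumr_ge0 => i _; exact: sqr_ge0.
  apply: eq_bigr => j _; rewrite row_row_mx aff_row_mx !mxE addr0.
  rewrite (bigD1 j)//= big1 ?addr0 ?mxE ?eqxx ?mul1r// => i ij.
  by rewrite !mxE eq_sym (negbTE ij) mul0r.
pose L := k%:R * (k.+1%:R ^+ 2 * (2 * M) * (1 + rho ^+ 2)).
have L0 : 0 <= L by rewrite !mulr_ge0 ?addr_ge0 ?sqr_ge0.
(* [Phi v'] competes at [v], and its support in the ball of radius [rho] makes [quad_lipschitz]
   applicable. *)
have FL v v' : feasible M v -> feasible M v' -> F v <= F v' + L * `|v - v'|.
  move=> fv fv'; have [[tphi sphi] mphi _] := PhiP _ fv'.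
  have [_ _ /(_ _ tphi) h] := PhiP _ fv; apply: (le_trans h).
  have iq W := (quad_integrable tphi W).1.
  rewrite /F /trim_avg mphi -(ler_pM2l g0) mulrDr !mulVKf ?gt_eqF//.
  rewrite [X in _ + X]mulrC -[in leRHS]mphi /trim_mass.
  rewrite -RintegralZl//; last exact: (trim_class_integrable tphi).
  rewrite -RintegralD//; last exact: (integrableZl measurableT (L * `|v - v'|)
    (trim_class_integrable tphi)).
  apply: le_Rintegral => //.
    have i1 := integrableZl measurableT (L * `|v - v'|) (trim_class_integrable tphi).
    exact: (integrableD measurableT (iq _) i1).
  move=> x _; have [_ /(_ x)/andP[p0 p1] _ _] := tphi.
  have [->|px] := eqVneq (Phi v' x) 0; first by rewrite !mulr0 addr0.
  rewrite -mulrDl ler_wpM2r//; apply: quad_lipschitz => //.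
  - by move=> i j; exact: feasible_entry.
  - by move=> i j; exact: feasible_entry.
  - move=> i j; have := mx_entry_le_norm (v - v') 0 (mxvec_index i j).
    by rewrite !mxE.
  - exact: sphi.
have cF : {within feasible M, continuous F}.
  apply/subspace_continuousP => v fv; apply/cvgrPdist_lt => e e0.
  have eL : 0 < e / (L + 1) by rewrite divr_gt0// ltr_wpDl.
  rewrite near_withinE; apply/nbhs_ballP; exists (e / (L + 1)) => //= v'.
  rewrite -ball_normE /= => vv' fv'.
  have le_e : L * `|v - v'| < e.
    apply: (@le_lt_trans _ _ ((L + 1) * `|v - v'|));
      last by rewrite mulrC -ltr_pdivlMr// ltr_wpDl.
    by rewrite ler_wpM2r// lerDl.
  have h1 := FL _ _ fv fv'; have h2 := FL _ _ fv' fv.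
  rewrite (distrC v' v) in h2.
  rewrite ltr_norml ltrBlDl ltrBrDr [- e + _]addrC ltrBlDr.
  by rewrite (le_lt_trans h2) ?ltrD2l// (le_lt_trans h1) ?ltrD2l.
have [v /set_mem fv vmin] := EVT_min_rV (ex_intro _ _ fW0) (@feasible_compact M) cF.
have [tphi mphi _] := PhiP _ fv.
exists (Phi v); split=> //; split; first exact: tphi.1.
move=> psi tpsi.
(* The determinant at [Phi v] is at most [(F v / k)^k], while that of [psi] is attained by some [W];
   it remains to compare the two averages. *)
apply: (le_trans (det_trim_cov_le g0 tphi.1 (posC _ tphi.1) fv.2)).
have [W [dW <-]] := det_trim_covE g0 tpsi (posC _ tpsi).
have F0 : 0 <= F v.
  rewrite /F /trim_avg mphi mulr_ge0 ?invr_ge0 ?(ltW g0)//.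
  apply: Rintegral_ge0 => x _; rewrite mulr_ge0 ?quad_ge0//.
  by have [[_ /(_ x)/andP[]]] := tphi.
suff FW : F v <= trim_avg Q psi W.
  by rewrite lerXn2r ?nnegrE ?divr_ge0 ?(le_trans F0 FW)// ler_wpM2r// invr_ge0.
(* An average above [r^2] already loses to [W0]; otherwise coercivity places [W] in the feasible
   set. *)
have [Wr|/ltW Wr] := leP (trim_avg Q psi W) (r ^+ 2); last first.
  by apply: le_trans Wr; apply: le_trans FW0; apply: vmin; exact: mem_set.
have WM i j : `|W i j| <= M.
  have := le_trans (trim_avg_ge g0 tpsi W c0 (coer' _ tpsi) i j) Wr.
  rewrite mulrC -ler_pdivlMr// => h; rewrite /M.
  move: (normr_ge0 (W i j)) h rc0; move: (r ^+ 2 / c) => a; nra.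
have fW := feasible_mxvec M0 WM dW.
apply: (le_trans (vmin _ (mem_set fW))).
have [_ _ h] := PhiP _ fW; apply: (le_trans (h psi tpsi)).
by rewrite mxvecK.
Qed.

End existence.

(** * A common radius for the limit measure and the tail of the sequence *)

Theorem theorem3p1 (R : realType) (k : nat) (gamma : R)
    (P : nat -> probability (borelRV R k) R)
    (gamma_gt0 : 0 < gamma) (gamma_lt1 : gamma < 1)
    (P0_hyperplane : forall H : set 'rV[R]_k, hyperplane H ->
       (P 0%N H < gamma%:E)%E)
    (P_weak_cvg : weak_cvg P (P 0%N)) :
  exists (r : R) (t0 : nat), [/\ 0 < r, (1 <= t0)%N &
    forall t : nat, (t = 0%N \/ (t0 <= t)%N) ->
      exists phi : borelRV R k -> R,
        trim_class_ball (P t) gamma r phi /\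
        minimizes_det_cov (P t) gamma phi].
Proof.
(* The limit measure is treated through the constant sequence, for which an eventual property at any
   one index is a property of [P 0]. *)
have P0_cvg : weak_cvg (fun=> P 0%N) (P 0%N) by move=> f _ _; exact: cvg_cst.
have [c c_gt0 coer] := uniform_coercivity gamma_gt0 P0_hyperplane P_weak_cvg.
have [r r_gt0 tight] := tightness gamma_lt1 P_weak_cvg.
have [c' c'_gt0 coer'] := uniform_coercivity gamma_gt0 P0_hyperplane P0_cvg.
have [r' r'_gt0 tight'] := tightness gamma_lt1 P0_cvg.
have g01 : 0 < gamma < 1 by rewrite gamma_gt0.
have [rho rho_gt0 ex] := exists_minimizer k g01 c_gt0 r_gt0.
have [rho' rho'_gt0 ex'] := exists_minimizer k g01 c'_gt0 r'_gt0.
have [N _ NP] := filterI coer tight.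
have [t [coer0 tight0]] := filter_ex (filterI coer' tight').
have widen Q s s' phi : s <= s' -> trim_class_ball Q gamma s phi ->
    trim_class_ball Q gamma s' phi.
  by move=> ss' [tphi sphi]; split=> // x /sphi /le_trans; apply.
(* The larger radius serves both cases, and the successor ensures [1 <= t0]. *)
exists (Num.max rho rho'), N.+1; split=> //; first by rewrite lt_max rho_gt0.
move=> u [->|Nu].
  have [phi [bphi mphi]] := ex' _ coer0 tight0.
  by exists phi; split=> //; apply: widen bphi; rewrite le_max lexx orbT.
have [coeru tightu] := NP u (ltnW Nu).
have [phi [bphi mphi]] := ex _ coeru tightu.
by exists phi; split=> //; apply: widen bphi; rewrite le_max lexx.
Qed.
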